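(* Let $k$ be an algebraically closed field of characteristic zero, and let $X\subset\mathbb{P}^4_{x_1,\dots,x_5}$ be the cubic threefold over $k$ given by $$x_1x_4^2+x_2x_4x_5+x_3x_5^2=0.$$ Let $G\subset\mathrm{Aut}(X)$ be a finite group. Then the $G$-action on $X$ is linearizable.
   Context: A $G$-action on $\mathbb{P}^n$ is called linear if it arises from the projectivization $\mathbb{P}(V)$ of a $G$-representation $V$. A $G$-action on an $n$-dimensional projective variety $X$ is linearizable if $X$ is $G$-equivariantly birational to $\mathbb{P}^n$ with a linear $G$-action. *)

(* Defs.v *)
(* Mathematical Components.  Varieties over an algebraically closed field are
   represented classically, by their sets of k-points. *)
From HB Require Import structures.
From mathcomp Require Import all_boot all_order all_algebra all_fingroup.
From mathcomp Require Import mxrepresentation.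
From mathcomp Require Import mpoly.

Set Implicit Arguments.
Unset Strict Implicit.
Unset Printing Implicit Defensive.

Import GRing.Theory.
Local Open Scope ring_scope.

(* P^n = P(k^(n+1)), the space of lines through the origin. *)
Definition proj (k : fieldType) (n : nat) : Type :=
  {L : {vspace 'rV[k]_n.+1} | \dim L == 1%N}.

Definition line (k : fieldType) (n : nat) (x : proj k n) :
  {vspace 'rV[k]_n.+1} := val x.

(* A choice of homogeneous coordinates: vpick L is a nonzero vector of L. *)
Definition hcoord (k : fieldType) (n : nat) (x : proj k n) : 'I_n.+1 -> k :=
  fun i => vpick (line x) 0 i.

(* Only used for homogeneous p, where it does not depend on the choice made in
   hcoord. *)
Definition vanishes (k : fieldType) (n : nat) (p : {mpoly k[n.+1]})
  (x : proj k n) : bool := p.@[hcoord x] == 0.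

Definition points (k : fieldType) (n : nat) (S : {pred proj k n}) : Type :=
  {x : proj k n | x \in S}.

Definition pt (k : fieldType) (n : nat) (S : {pred proj k n}) (x : points S) :
  proj k n := val x.

Definition projective_space (k : fieldType) (n : nat) : {pred proj k n} :=
  [pred _ : proj k n | true].
Arguments projective_space : clear implicits.

(* U is open in S for the Zariski topology, i.e. it is a union of principal
   open subsets {h <> 0} of S. *)
Definition zariski_open (k : fieldType) (n : nat) (S U : {pred proj k n}) :
  Prop :=
  {subset U <= S} /\
  forall x, x \in U ->
    exists (e : nat) (h : {mpoly k[n.+1]}),
      [/\ h \is e.-homog, ~~ vanishes h x &
          forall y, y \in S -> ~~ vanishes h y -> y \in U].

(* It suffices to meet the nonempty principal open subsets of S. *)
Definition zariski_dense (k : fieldType) (n : nat) (S U : {pred proj k n}) :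
  Prop :=
  {subset U <= S} /\
  forall (e : nat) (h : {mpoly k[n.+1]}), h \is e.-homog ->
    (exists2 x, x \in S & ~~ vanishes h x) ->
    exists2 x, x \in U & ~~ vanishes h x.

(* f is a morphism between locally closed subsets of projective spaces: near
   each point it is y |-> [F_0(y) : ... : F_m(y)] for forms F_j of a common
   degree d.  The F_j have no common zero in the neighbourhood {h <> 0}, since
   line (pt (f y)) is not the zero subspace. *)
Definition regular (k : fieldType) (n m : nat) (S : {pred proj k n})
  (T : {pred proj k m}) (f : points S -> points T) : Prop :=
  forall x : points S,
    exists (d e : nat) (F : 'I_m.+1 -> {mpoly k[n.+1]}) (h : {mpoly k[n.+1]}),
      [/\ forall j, F j \is d.-homog,
          h \is e.-homog,
          ~~ vanishes h (pt x) &
          forall y : points S, ~~ vanishes h (pt y) ->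
            line (pt (f y)) = <[\row_j (F j).@[hcoord (pt y)]]>%VS].

(* Group actions are right actions, as everywhere in the library; this also
   applies to representations, which act on row vectors by v *m rG g. *)

(* gT is identified with a finite subgroup of the group Aut(S) of regular
   automorphisms of S (the inverse of to^~ g is to^~ g^-1). *)
Definition finite_subgroup_Aut (k : fieldType) (n : nat) (S : {pred proj k n})
  (gT : finGroupType) (to : {action gT &-> points S}) : Prop :=
  (forall g : gT, regular (fun x : points S => to x g)) /\
  (forall g : gT, (forall x : points S, to x g = x) -> g = 1%g).

Definition linear_action (k : fieldType) (n : nat) (gT : finGroupType)
  (to : {action gT &-> points (projective_space k n)}) : Prop :=
  exists rG : mx_representation k [set: gT] n.+1,
    forall (x : points (projective_space k n)) (g : gT),
      line (pt (to x g)) = (linfun (mulmxr (rG g)) @: line (pt x))%VS.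

(* A birational map is an isomorphism f : U -> W between dense open subsets; it
   is equivariant if f \o g and g \o f agree as rational maps, i.e. wherever f
   is defined at both a and a.g. *)
Definition equivariantly_birational (k : fieldType) (n m : nat)
  (S : {pred proj k n}) (T : {pred proj k m}) (gT : finGroupType)
  (toS : {action gT &-> points S}) (toT : {action gT &-> points T}) : Prop :=
  exists (U : {pred proj k n}) (W : {pred proj k m})
         (f : points U -> points W) (f' : points W -> points U),
    [/\ zariski_open S U /\ zariski_dense S U,
        zariski_open T W /\ zariski_dense T W,
        regular f /\ regular f',
        cancel f f' /\ cancel f' f &
        forall (g : gT) (a : points S) (b : points T) (x y : points U),
          pt x = pt a -> pt y = pt (toS a g) -> pt (f x) = pt b ->
          pt (f y) = pt (toT b g)].

(* n is meant to be the dimension of S. *)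
Definition linearizable (k : fieldType) (N : nat) (S : {pred proj k N})
  (gT : finGroupType) (n : nat) (to : {action gT &-> points S}) : Prop :=
  exists toP : {action gT &-> points (projective_space k n)},
    linear_action toP /\ equivariantly_birational to toP.

(* x_1, ..., x_5 are 'X_0, ..., 'X_4. *)
Definition cubic_form (k : fieldType) : {mpoly k[5]} :=
  let x (i : nat) : {mpoly k[5]} := 'X_(inord i.-1) in
  x 1%N * x 4%N ^+ 2 + x 2%N * x 4%N * x 5%N + x 3%N * x 5%N ^+ 2.

Definition cubic_threefold (k : fieldType) : {pred proj k 4} :=
  [pred x | vanishes (cubic_form k) x].
Arguments cubic_threefold : clear implicits.

(* Main.v *)
Require Import Defs.
From HB Require Import structures.
From mathcomp Require Import all_boot all_order all_algebra all_fingroup.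
From mathcomp Require Import mxrepresentation.
From mathcomp Require Import mpoly.
From mathcomp Require Import ring zify.

(** The cubic X is swept out by a family of planes, indexed by P^1: its
    normalization is P^1 x P^2, with the map nu below, which takes a point w of
    P^1 and a point (y, c) of P^2 to nu w y c. The map nu is injective except
    over the plane S given by x_4 = x_5 = 0; this is the image of the locus
    c = 0, where nu w y 0 = nu y w 0. Off S, X is the product of P^1 with an
    affine plane.

    Every regular automorphism of X is linear in these coordinates: there are
    L in GL_2 and a vector b such that nu w y 1 goes to
    nu (w L) (y L + b) 1 (automorphism_linear). The proof restricts the
    automorphism to lines contained in X, where a regular map is a tuple of
    polynomials in one variable without common zeros (line_image), whose
    leading coefficients are the image of the point at infinity (line_limit).
    First, S is preserved (plane_image): at its general points the tangent
    space of the cone over X is all of k^5, so the differential, which is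
    invertible there, cannot lead to a smooth point of X, where the tangent
    space is a hyperplane. Then the line of all nu w y 1 with y fixed goes to a
    curve in the complement of S, whose affine coordinate is constant because
    P^1 is complete (fiber_image), so that y has a well defined image.
    Conversely the image of w does not depend on y (base_const_line): if it
    varied along a line of the affine plane, its limit at the point at infinity
    would be the same for all w, against injectivity. So w is moved by an
    injective endomorphism of P^1, which is linear in characteristic zero
    (degree_one). Finally the points at infinity of the lines in the variable
    y lie on S, where w and y can be exchanged: this determines the directions
    of the image curves, and the differential shows that these curves are lines
    (line_to_line).

    For a finite group the translation parts b are removed by the choice of a
    fixed point as origin (diagonal_action), and the action on X becomes
    birationally the action on P(V) x V of a representation V of dimension two.
    Let l be a linear form on V and let F be the product of its conjugates
    under the group, which is an invariant. Then the map
      ([w], v) |-> [w : w /\ v : (w /\ v)^2 dF_w(v) / F(w)]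
    to P(V + det + det^2) is homogeneous of degree one in w and equivariant.
    It is birational: for fixed w, the last two coordinates determine the
    values of the linear forms w /\ v and dF_w(v) of v, independent because
    dF_w(w) = |G| F(w). *)

Set Implicit Arguments.
Unset Strict Implicit.
Unset Printing Implicit Defensive.

Import GRing.Theory.
Local Open Scope ring_scope.

(** * Evaluation of forms along polynomial curves *)

Section Curves.

Variables (k : fieldType) (n : nat).
Implicit Types (p : {mpoly k[n]}) (V : 'rV[{poly k}]_n) (x : 'rV[k]_n).

Definition pt_at m (t : k) (V : 'rV[{poly k}]_m) : 'rV[k]_m :=
  map_mx (horner_eval t) V.

Definition ray x q : 'rV[{poly k}]_n := map_mx polyC x + 'X *: map_mx polyC q.

Definition along p V : {poly k} := mmap polyC (V 0) p.

Lemma pt_atE m t (V : 'rV[{poly k}]_m) i : pt_at t V 0 i = (V 0 i).[t].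
Proof. by rewrite mxE. Qed.

Lemma pt_at_ray t x q : pt_at t (ray x q) = x + t *: q.
Proof. by apply/rowP=> i; rewrite !mxE /horner_eval !hornerE. Qed.

Lemma mpoly_closure (P : {mpoly k[n]} -> Prop) :
    (forall c, P c%:MP) -> (forall i, P 'X_i) ->
    (forall p q, P p -> P q -> P (p + q)) ->
    (forall p q, P p -> P q -> P (p * q)) -> forall p, P p.
Proof.
move=> PC PX PD PM p; rewrite (mpolyE p).
have P0 : P 0 by have := PC 0; rewrite mpolyC0.
have P1 : P 1 by have := PC 1; rewrite mpolyC1.
apply: (big_ind P) => // m _; rewrite -mul_mpolyC; apply: (PM) => //.
rewrite mpolyXE_id; apply: (big_ind P) => // i _.
by elim: (m i) => [|j IH]; rewrite ?expr0 // exprS; apply: PM.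
Qed.

Lemma mmap_homog (S : comNzRingType) (h : {rmorphism k -> S}) (f : 'I_n -> S)
    (c : S) d p : p \is d.-homog ->
  mmap h (fun i => c * f i) p = c ^+ d * mmap h f p.
Proof.
move=> /dhomogP hp; rewrite /mmap mulr_sumr; apply: eq_big_seq => m /hp <-.
rewrite mulrCA; congr (_ * _); rewrite /mmap1 /= mdegE -prodrXr -big_split /=.
by apply: eq_bigr => i _; rewrite exprMn.
Qed.

Lemma meval_homog (c : k) d p x : p \is d.-homog ->
  p.@[(c *: x) 0] = c ^+ d * p.@[x 0].
Proof.
move=> hp; rewrite -(mmap_homog idfun (x 0) c hp) /meval.
by apply: eq_bigr => m _; congr (_ * _); apply: eq_bigr => i _; rewrite mxE.
Qed.

Lemma along_homog (c : {poly k}) d p V : p \is d.-homog ->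
  along p (c *: V) = c ^+ d * along p V.
Proof.
move=> hp; rewrite /along -(mmap_homog (@polyC k) (V 0) c hp).
by apply: eq_bigr => m _; congr (_ * _); apply: eq_bigr => i _; rewrite mxE.
Qed.

Lemma alongD p1 p2 V : along (p1 + p2) V = along p1 V + along p2 V.
Proof. exact: mmapD. Qed.

Lemma alongM p1 p2 V : along (p1 * p2) V = along p1 V * along p2 V.
Proof. exact: rmorphM. Qed.

Lemma alongC c V : along c%:MP V = c%:P.
Proof. exact: mmapC. Qed.

Lemma alongX i V : along 'X_i V = V 0 i.
Proof. by rewrite /along mmapX mmap1U. Qed.

Lemma horner_along p V t : (along p V).[t] = p.@[pt_at t V 0].
Proof.
elim/mpoly_closure: p => [c|i|p q IHp IHq|p q IHp IHq].
- by rewrite alongC mevalC hornerC.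
- by rewrite alongX mevalXU mxE.
- by rewrite alongD mevalD hornerD IHp IHq.
- by rewrite alongM mevalM hornerM IHp IHq.
Qed.

Lemma along_const p x : along p (map_mx polyC x) = (p.@[x 0])%:P.
Proof.
elim/mpoly_closure: p => [c|i|p q IHp IHq|p q IHp IHq].
- by rewrite alongC mevalC.
- by rewrite alongX mevalXU mxE.
- by rewrite alongD mevalD polyCD IHp IHq.
- by rewrite alongM mevalM polyCM IHp IHq.
Qed.

Lemma coef1M (a b : {poly k}) : (a * b)`_1 = a`_0 * b`_1 + a`_1 * b`_0.
Proof. by rewrite coefM !big_ord_recl big_ord0 /= /bump /= addr0. Qed.

Lemma coef1_exp d : ((1 + 'X : {poly k}) ^+ d)`_1 = d%:R.
Proof.
elim: d => [|d IH]; first by rewrite expr0 coef1.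
rewrite exprS coef1M IH -!horner_coef0 !hornerE expr1n !coefD coef1 coefX.
by rewrite mulrS /=; ring.
Qed.

(** The chain rule: c is the gradient of p at x, and it serves for all curves
    through x at once. *)
Lemma gradient p x : exists c : 'rV[k]_n, forall V, pt_at 0 V = x ->
  (along p V)`_1 = \sum_i c 0 i * (V 0 i)`_1.
Proof.
elim/mpoly_closure: p => [c|i|p q [cp hp] [cq hq]|p q [cp hp] [cq hq]].
- exists 0 => V _; rewrite alongC coefC /= big1 // => i _.
  by rewrite mxE mul0r.
- exists (delta_mx 0 i) => V _; rewrite alongX (bigD1 i) //= mxE !eqxx mul1r.
  by rewrite big1 ?addr0 // => j /negPf ne; rewrite mxE ne andbF mul0r.
- exists (cp + cq) => V hV; rewrite alongD coefD hp // hq // -big_split /=.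
  by apply: eq_bigr => i _; rewrite mxE mulrDl.
- exists (p.@[x 0] *: cq + q.@[x 0] *: cp) => V hV.
  rewrite alongM coef1M -!horner_coef0 !horner_along hV hp // hq //.
  rewrite mulr_sumr mulr_suml -big_split /=.
  by apply: eq_bigr => i _; rewrite !mxE; ring.
Qed.

End Curves.

(** * Tuples of polynomials without common zeros *)

Section Unimodular.

Variable k : closedFieldType.

Lemma poly_eq0_generic (h p : {poly k}) : h != 0 ->
  (forall t, h.[t] != 0 -> p.[t] = 0) -> p = 0.
Proof.
move=> h0 hp; apply/eqP; apply: contraT => p0.
have /closed_nonrootP [t] : h * p != 0 by rewrite mulf_neq0.
rewrite rootE hornerM mulf_eq0 negb_or => /andP[ht].
by rewrite hp ?eqxx.
Qed.

Lemma nonroot (p : {poly k}) : p != 0 -> exists t, p.[t] != 0.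
Proof. by move=> /closed_nonrootP. Qed.

(** Coprimality of the coordinates in the form of a Bezout identity, which
    allows division; the field being algebraically closed, it means that the
    coordinates have no common zero. *)
Definition unimodular n (V : 'rV[{poly k}]_n) : Prop :=
  exists S : 'I_n -> {poly k}, \sum_i S i * V 0 i = 1.

Lemma tuple_gcd n (f : 'I_n -> {poly k}) :
  exists (d : {poly k}) (S : 'I_n -> {poly k}),
  d = \sum_i S i * f i /\ forall i, d %| f i.
Proof.
elim: n f => [|n IH] f.
  by exists 0, (fun=> 0); split=> [|[]//]; rewrite big_ord0.
have [d [S [dE dv]]] := IH (fun i => f (lift ord0 i)).
have [[u v] /= e] := Bezoutp (f ord0) d.
exists (u * f ord0 + v * d),
  (fun i => if unlift ord0 i is Some j then v * S j else u); split.
  rewrite big_ord_recl unlift_none; congr (_ + _).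
  rewrite dE mulr_sumr; apply: eq_bigr => i _.
  by rewrite liftK mulrA.
move=> i; rewrite (eqp_dvdl _ e); case: (unliftP ord0 i) => [j|] ->.
  by apply: dvdp_trans (dvdp_gcdr _ _) (dv j).
exact: dvdp_gcdl.
Qed.

Lemma tuple_primitive n (V : 'rV[{poly k}]_n) : V != 0 ->
  exists d W, [/\ d != 0, V = d *: W & unimodular W].
Proof.
move=> V0; have [d [S [dE dv]]] := tuple_gcd (V 0).
have d0 : d != 0.
  apply: contraNneq V0 => d0; apply/eqP/rowP => i; rewrite mxE.
  by have := dv i; rewrite d0 dvd0p => /eqP.
exists d, (\row_i (V 0 i %/ d)); split=> //.
  by apply/rowP => i; rewrite !mxE mulrC divpK.
exists S; apply: (mulIf d0); rewrite mul1r [RHS]dE mulr_suml.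
by apply: eq_bigr => i _; rewrite mxE -mulrA divpK.
Qed.

Lemma unimodular_at n (V : 'rV[{poly k}]_n) t : unimodular V -> pt_at t V != 0.
Proof.
case=> S /(congr1 (horner_eval t)) e; apply/eqP => V0.
have: (1 : k) = 0.
  rewrite -[LHS](_ : horner_eval t 1 = 1); last by rewrite /horner_eval hornerC.
  rewrite -e raddf_sum big1 // => i _; have /rowP/(_ i) := V0.
  by rewrite !mxE /= => Vi; rewrite rmorphM /= Vi mulr0.
by move/eqP; rewrite oner_eq0.
Qed.

Lemma unimodularP n (V : 'rV[{poly k}]_n) :
  (forall t, pt_at t V != 0) -> unimodular V.
Proof.
move=> nz; have V0 : V != 0.
  by apply: contraNneq (nz 0) => ->; rewrite /pt_at map_mx0.
have [d [W [d0 VE [S SW]]]] := tuple_primitive V0.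
have ud : d \is a GRing.unit.
  rewrite poly_unitE; have /eqP sd : size d == 1%N.
    apply: contraT => /closed_rootP [t /eqP dt]; case/eqP: (nz t).
    by apply/rowP => i; rewrite VE !mxE /horner_eval hornerM dt mul0r.
  by rewrite sd eqxx /= unitfE -[0%N]/(1.-1) -sd -lead_coefE lead_coef_eq0.
exists (fun i => S i / d); rewrite -SW; apply: eq_bigr => i _.
by rewrite VE mxE mulrA divrK.
Qed.

Definition collinear m (x y : 'rV[k]_m) := exists2 c : k, c != 0 & y = c *: x.

Lemma collinear_sym m (x y : 'rV[k]_m) : collinear x y -> collinear y x.
Proof.
case=> c c0 ->; exists c^-1; first by rewrite invr_eq0.
by rewrite scalerA mulVf // scale1r.
Qed.

Lemma collinear_refl m (x : 'rV[k]_m) : collinear x x.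
Proof. by exists 1; rewrite ?oner_eq0 ?scale1r. Qed.

Lemma collinear_trans m (y x z : 'rV[k]_m) :
  collinear x y -> collinear y z -> collinear x z.
Proof.
by case=> c c0 -> [d d0 ->]; exists (d * c); rewrite ?mulf_neq0 ?scalerA.
Qed.

(** Two polynomial curves with the same generic image: a coprime tuple of
    coordinates divides every other one. *)
Lemma unimodular_factor n (R V : 'rV[{poly k}]_n) (h : {poly k}) : h != 0 ->
  (forall t, h.[t] != 0 -> collinear (pt_at t V) (pt_at t R)) -> unimodular V ->
  exists C, R = C *: V.
Proof.
move=> h0 hp [S SV]; exists (\sum_i S i * R 0 i); apply/rowP=> j.
rewrite mxE -[LHS]mul1r -SV !mulr_suml; apply: eq_bigr => i _.
suff e : V 0 i * R 0 j = R 0 i * V 0 j by rewrite -mulrA e mulrA.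
apply/eqP; rewrite -subr_eq0; apply/eqP; apply: poly_eq0_generic h0 _.
move=> t /hp [c c0 /rowP e]; have := e i; have := e j.
rewrite !mxE /horner_eval hornerD hornerN !hornerM => -> ->; ring.
Qed.

End Unimodular.

(** * The parametrization of the cubic by P^1 x P^2 *)

Lemma ord2_ind (P : 'I_2 -> Prop) : P 0 -> P 1 -> forall i, P i.
Proof.
move=> P0 P1 [[|[|//]] i2].
  by rewrite [Ordinal _](_ : _ = 0) //; apply: val_inj.
by rewrite [Ordinal _](_ : _ = 1) //; apply: val_inj.
Qed.

Section Coordinates.

Variable R : comNzRingType.
Implicit Types (w y : 'rV[R]_2) (x : 'rV[R]_5).

(** Coordinates are numbered from 0, so crd x i is the coordinate x_(i+1) of the
    equation of X. *)
Definition crd x (i : nat) : R := x 0 (inord i).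

Definition mk2 (a b : R) : 'rV[R]_2 := \row_i nth 0 [:: a; b] i.

Definition cubic x : R :=
  crd x 0 * crd x 3 ^+ 2 + crd x 1 * crd x 3 * crd x 4 + crd x 2 * crd x 4 ^+ 2.

(** The normalization of X: the Segre embedding of P^1 x P^2 in P^5, with
    coordinates (y, c) on the second factor, followed by a projection from a
    point to P^4. On c = 0 it identifies (w, y) with (y, w). *)
Definition nu w y (c : R) : 'rV[R]_5 :=
  \row_i nth 0 [:: y 0 1 * w 0 1; - (y 0 0 * w 0 1 + y 0 1 * w 0 0);
                   y 0 0 * w 0 0; c * w 0 0; c * w 0 1] i.

Definition wedge w y : R := w 0 0 * y 0 1 - w 0 1 * y 0 0.

Lemma crd_inj x x' : crd x 0 = crd x' 0 -> crd x 1 = crd x' 1 ->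
  crd x 2 = crd x' 2 -> crd x 3 = crd x' 3 -> crd x 4 = crd x' 4 -> x = x'.
Proof.
rewrite /crd => e0 e1 e2 e3 e4; apply/rowP=> i; rewrite -(inord_val i).
by case: i => -[|[|[|[|[|//]]]]] ?.
Qed.

Lemma row2_eq w y : w 0 0 = y 0 0 -> w 0 1 = y 0 1 -> w = y.
Proof.
by move=> e0 e1; apply/rowP; apply: ord2_ind.
Qed.

Lemma mulmx2 w (L : 'M[R]_2) j :
  (w *m L) 0 j = w 0 0 * L 0 j + w 0 1 * L 1 j.
Proof.
rewrite mxE !big_ord_recl big_ord0 addr0.
by rewrite [lift _ _](_ : _ = 1) //; apply: val_inj.
Qed.

Lemma wedge_mulmx w v (L : 'M[R]_2) :
  wedge (w *m L) (v *m L) = (L 0 0 * L 1 1 - L 0 1 * L 1 0) * wedge w v.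
Proof. by rewrite /wedge !mulmx2; ring. Qed.

Lemma mk2_0 a b : mk2 a b 0 0 = a. Proof. by rewrite mxE. Qed.
Lemma mk2_1 a b : mk2 a b 0 1 = b. Proof. by rewrite mxE. Qed.
Definition mk2E := (mk2_0, mk2_1).

Lemma crdD x x' i : crd (x + x') i = crd x i + crd x' i.
Proof. by rewrite /crd mxE. Qed.
Lemma crdZ a x i : crd (a *: x) i = a * crd x i.
Proof. by rewrite /crd mxE. Qed.
Lemma crd0 i : crd (0 : 'rV[R]_5) i = 0.
Proof. by rewrite /crd mxE. Qed.
Definition crdE := (crdD, crdZ, crd0).

Lemma nu_0 w y c : crd (nu w y c) 0 = y 0 1 * w 0 1.
Proof. by rewrite /crd /nu mxE inordK. Qed.
Lemma nu_1 w y c : crd (nu w y c) 1 = - (y 0 0 * w 0 1 + y 0 1 * w 0 0).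
Proof. by rewrite /crd /nu mxE inordK. Qed.
Lemma nu_2 w y c : crd (nu w y c) 2 = y 0 0 * w 0 0.
Proof. by rewrite /crd /nu mxE inordK. Qed.
Lemma nu_3 w y c : crd (nu w y c) 3 = c * w 0 0.
Proof. by rewrite /crd /nu mxE inordK. Qed.
Lemma nu_4 w y c : crd (nu w y c) 4 = c * w 0 1.
Proof. by rewrite /crd /nu mxE inordK. Qed.
Definition nuE := (nu_0, nu_1, nu_2, nu_3, nu_4).

Lemma cubic_nu w y c : cubic (nu w y c) = 0.
Proof. rewrite /cubic !nuE; ring. Qed.

Lemma nuZl a w y c : nu (a *: w) y c = a *: nu w y c.
Proof. by apply: crd_inj; rewrite !crdZ !nuE ?mxE; ring. Qed.

Lemma nuZr a w y c : nu w (a *: y) (a * c) = a *: nu w y c.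
Proof. by apply: crd_inj; rewrite !crdZ !nuE ?mxE; ring. Qed.

Lemma nuDr w y y' c c' : nu w (y + y') (c + c') = nu w y c + nu w y' c'.
Proof. by apply: crd_inj; rewrite !crdD !nuE ?mxE; ring. Qed.

Lemma nuDl w w' y c : nu (w + w') y c = nu w y c + nu w' y c.
Proof. by apply: crd_inj; rewrite !crdD !nuE ?mxE; ring. Qed.

Lemma nu_sym w y : nu w y 0 = nu y w 0.
Proof. by apply: crd_inj; rewrite !nuE; ring. Qed.

(** Off the plane x_4 = x_5 = 0 the parametrization has a regular inverse: the
    coordinates of y, which are the ratios x_3 / x_4 and x_1 / x_5 wherever
    these make sense, are polynomials once x_4 and x_5 generate the unit
    ideal. *)
Lemma nu_lift x A B : cubic x = 0 -> A * crd x 3 + B * crd x 4 = 1 ->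
  exists y, x = nu (mk2 (crd x 3) (crd x 4)) y 1.
Proof.
rewrite /cubic => cx AB.
set x0 := crd x 0 in cx *; set x1 := crd x 1 in cx *.
set x2 := crd x 2 in cx *; set x3 := crd x 3 in cx AB *.
set x4 := crd x 4 in cx AB *.
have AB2 : (A * x3 + B * x4) ^+ 2 = 1 by rewrite AB expr1n.
exists (mk2 (A ^+ 2 * (x2 * x3) + (A * B * (x2 * x4)) *+ 2
               - B ^+ 2 * (x1 * x4 + x0 * x3))
            (- A ^+ 2 * (x1 * x3 + x2 * x4) + (A * B * (x0 * x3)) *+ 2
               + B ^+ 2 * (x0 * x4))).
apply: crd_inj; rewrite !nuE !mk2E -/x0 -/x1 -/x2 -/x3 -/x4 ?mul1r //.
- rewrite -[LHS]mulr1 -AB2 -[RHS]addr0 -(mulr0 (A ^+ 2)) -cx; ring.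
- rewrite -[LHS]mulr1 -AB2 -[RHS]addr0 -(mulr0 (A * B *+ 2)) -cx; ring.
- rewrite -[LHS]mulr1 -AB2 -[RHS]addr0 -(mulr0 (B ^+ 2)) -cx; ring.
Qed.

End Coordinates.

Lemma map_nu (R S : comNzRingType) (f : {rmorphism R -> S}) w y c :
  map_mx f (nu w y c) = nu (map_mx f w) (map_mx f y) (f c).
Proof.
by apply: crd_inj; rewrite !nuE /crd /nu !mxE inordK //= ?rmorphN ?rmorphD ?rmorphM.
Qed.

Section Geometry.

Variable k : closedFieldType.
Implicit Types (w y : 'rV[k]_2) (x : 'rV[k]_5) (c : k).

Lemma row2_neq0 w : w != 0 -> (w 0 0 != 0) || (w 0 1 != 0).
Proof.
apply: contraNT; rewrite negb_or !negbK => /andP[/eqP e0 /eqP e1].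
by apply/eqP/row2_eq; rewrite mxE.
Qed.

Lemma wedge_eq0 w y : w != 0 -> y != 0 -> wedge w y = 0 -> collinear w y.
Proof.
move=> /row2_neq0/orP[]w0 y0 /eqP; rewrite subr_eq0 => /eqP e.
- have yE : y = (y 0 0 / w 0 0) *: w.
    apply: row2_eq; rewrite mxE; first by rewrite divfK.
    by apply: (mulfI w0); rewrite e; field.
  exists (y 0 0 / w 0 0) => //.
  by apply: contraNneq y0 => z; rewrite yE z scale0r.
- have yE : y = (y 0 1 / w 0 1) *: w.
    apply: row2_eq; rewrite mxE; last by rewrite divfK.
    by apply: (mulfI w0); rewrite -e; field.
  exists (y 0 1 / w 0 1) => //.
  by apply: contraNneq y0 => z; rewrite yE z scale0r.
Qed.

Lemma collinear_wedge w y : collinear w y -> wedge w y = 0.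
Proof. by case=> a _ ->; rewrite /wedge !mxE; ring. Qed.

Lemma nu_eq0 w y c : w != 0 -> nu w y c = 0 -> y = 0 /\ c = 0.
Proof.
move=> w0 e; have E i : crd (nu w y c) i = 0 by rewrite e crd0.
have := (E 0, E 1, E 2, E 3, E 4); rewrite !nuE => -[[[[e0 e1] e2] e3] e4].
case/row2_neq0/orP: w0 => w0.
- have c0 : c = 0 by apply: (mulIf w0); rewrite mul0r.
  have y0 : y 0 0 = 0 by apply: (mulIf w0); rewrite mul0r.
  split=> //; apply: row2_eq; rewrite mxE //; apply: (mulIf w0); rewrite mul0r.
  by move/eqP: e1; rewrite y0 mul0r add0r oppr_eq0 => /eqP.
- have c0 : c = 0 by apply: (mulIf w0); rewrite mul0r.
  have y1 : y 0 1 = 0 by apply: (mulIf w0); rewrite mul0r.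
  split=> //; apply: row2_eq; rewrite mxE //; apply: (mulIf w0); rewrite mul0r.
  by move/eqP: e1; rewrite y1 mul0r addr0 oppr_eq0 => /eqP.
Qed.

Lemma nu_neq0 w y c : w != 0 -> (y != 0) || (c != 0) -> nu w y c != 0.
Proof.
move=> w0; apply: contraL => /eqP /(nu_eq0 w0)[-> ->].
by rewrite !eqxx.
Qed.

Lemma nu_inj w y y' c c' : w != 0 -> nu w y c = nu w y' c' ->
  y = y' /\ c = c'.
Proof.
move=> w0 /eqP; rewrite -subr_eq0 -scaleN1r -nuZr -nuDr => /eqP/(nu_eq0 w0).
by rewrite scaleN1r mulN1r => -[/subr0_eq-> /subr0_eq->].
Qed.

(** A point of X has at most two preimages, and two preimages over distinct
    points of P^1 are exchanged by the symmetry of nu w y 0. *)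
Lemma nu_separate w w' y y' c c' : w != 0 -> wedge w w' != 0 ->
  (y != 0) || (c != 0) -> collinear (nu w y c) (nu w' y' c') ->
  c = 0 /\ collinear y w'.
Proof.
move=> w0 ww yc [a a0 e].
have w'0 : w' != 0.
  by apply: contraNneq ww => ->; rewrite /wedge !mxE; apply/eqP; ring.
have E i : crd (nu w' y' c') i = a * crd (nu w y c) i by rewrite e crdZ.
have := (E 0, E 1, E 2, E 3, E 4); rewrite !nuE => -[[[[e0 e1] e2] e3] e4].
have c0 : c = 0.
  apply/eqP; have /eqP : a * c * wedge w w' = 0.
    rewrite /wedge.
    have -> : a * c * (w 0 0 * w' 0 1 - w 0 1 * w' 0 0) =
      a * (c * w 0 0) * w' 0 1 - a * (c * w 0 1) * w' 0 0 by ring.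
    by rewrite -e3 -e4; ring.
  by rewrite !mulf_eq0 (negPf a0) (negPf ww) orbF.
split=> //; move: yc; rewrite c0 eqxx orbF => y0.
apply: (wedge_eq0 y0 w'0); apply/eqP.
have /eqP : a * wedge y w' * wedge w w' = 0.
  rewrite /wedge.
  have -> : a * (y 0 0 * w' 0 1 - y 0 1 * w' 0 0) *
     (w 0 0 * w' 0 1 - w 0 1 * w' 0 0) =
     a * (y 0 1 * w 0 1) * w' 0 0 ^+ 2 +
     a * (- (y 0 0 * w 0 1 + y 0 1 * w 0 0)) * (w' 0 0 * w' 0 1) +
     a * (y 0 0 * w 0 0) * w' 0 1 ^+ 2 by ring.
  by rewrite -e0 -e1 -e2; ring.
by rewrite !mulf_eq0 (negPf a0) (negPf ww) orbF.
Qed.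

Lemma nu_inj1 w w' y y' : w != 0 -> collinear (nu w y 1) (nu w' y' 1) ->
  y = y' /\ collinear w w'.
Proof.
move=> w0 [a a0 e].
have w'E : w' = a *: w.
  have := congr1 (fun x => crd x 3) e; have := congr1 (fun x => crd x 4) e.
  by rewrite /= !crdE !nuE !mul1r => e4 e3; apply: row2_eq; rewrite mxE.
split; last by exists a.
move: e; rewrite w'E nuZl => /(scalerI a0) e.
by have [] := nu_inj w0 e.
Qed.

Lemma nu_inj0 w w' y : y != 0 -> collinear (nu w y 0) (nu w' y 0) -> collinear w w'.
Proof.
move=> y0 [a a0 e]; exists a => //; move: e; rewrite !(nu_sym _ y) -nuZr mulr0.
by move=> /(nu_inj y0)[].
Qed.

Lemma cubic_off x : cubic x = 0 -> (crd x 3 != 0) || (crd x 4 != 0) ->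
  exists y, x = nu (mk2 (crd x 3) (crd x 4)) y 1.
Proof.
move=> cx /orP[] h.
- by apply: (@nu_lift _ x (crd x 3)^-1 0 cx); rewrite mul0r addr0 mulVf.
- by apply: (@nu_lift _ x 0 (crd x 4)^-1 cx); rewrite mul0r add0r mulVf.
Qed.

(** A binary quadratic form over an algebraically closed field splits, so the
    plane x_4 = x_5 = 0 lies in the image of the parametrization. *)
Lemma plane_split x : crd x 3 = 0 -> crd x 4 = 0 ->
  exists w y, w != 0 /\ x = nu w y 0.
Proof.
move=> e3 e4; have [x0|x0] := eqVneq (crd x 0) 0.
  exists (mk2 (-1) 0), (mk2 (- crd x 2) (crd x 1)); split.
    by apply/eqP => /rowP/(_ 0)/eqP; rewrite mk2E mxE oppr_eq0 oner_eq0.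
  by apply: crd_inj; rewrite !nuE !mk2E ?e3 ?e4 ?x0; ring.
have [r hr] := @solve_monicpoly k 2
  (fun i => if i == 0%N then - crd x 2 / crd x 0 else - crd x 1 / crd x 0) isT.
move: hr; rewrite !big_ord_recl big_ord0 /= expr0 expr1 mulr1 addr0 => hr.
have {}hr : crd x 0 * r ^+ 2 = - crd x 2 - crd x 1 * r by rewrite hr; field.
exists (mk2 r 1), (mk2 (- crd x 1 - crd x 0 * r) (crd x 0)); split.
  by apply/eqP => /rowP/(_ 1)/eqP; rewrite mk2E mxE oner_eq0.
apply: crd_inj; rewrite !nuE !mk2E ?e3 ?e4; try ring.
by rewrite mulrBl -mulrA -expr2 hr; ring.
Qed.

Lemma cubic_param x : cubic x = 0 -> exists w y c, w != 0 /\ x = nu w y c.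
Proof.
move=> cx; have [/andP[/eqP e3 /eqP e4]|] :=
  boolP ((crd x 3 == 0) && (crd x 4 == 0)).
  have [w [y [w0 xE]]] := plane_split e3 e4.
  by exists w, y, 0.
rewrite negb_and => h; have [y xE] := cubic_off cx h.
exists (mk2 (crd x 3) (crd x 4)), y, 1; split=> //.
case/orP: h => h; apply: contraNneq h => /rowP z.
  by have := z 0; rewrite mk2E mxE => ->.
by have := z 1; rewrite mk2E mxE => ->.
Qed.

Lemma nu_neq01 w y : w != 0 -> nu w y 1 != 0.
Proof. by move=> w0; apply: nu_neq0; rewrite ?oner_neq0 ?orbT. Qed.

Lemma nu_generic_neq0 (w y : 'rV[k]_2) : wedge w y != 0 ->
  [/\ w != 0, y != 0 & nu w y 0 != 0].
Proof.
move=> wy; have w0 : w != 0.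
  by apply: contraNneq wy => ->; rewrite /wedge !mxE; apply/eqP; ring.
have y0 : y != 0.
  by apply: contraNneq wy => ->; rewrite /wedge !mxE; apply/eqP; ring.
by split=> //; apply: nu_neq0 => //; rewrite y0.
Qed.

Lemma exists_noncollinear w : w != 0 -> exists w', wedge w w' != 0.
Proof.
case/row2_neq0/orP => h0.
  by exists (mk2 0 1); rewrite /wedge !mk2E mulr1 mulr0 subr0.
by exists (mk2 1 0); rewrite /wedge !mk2E mulr0 mulr1 sub0r oppr_eq0.
Qed.

Lemma mk2_neq0l (a b : k) : a != 0 -> mk2 a b != 0 :> 'rV[k]_2.
Proof. by apply: contraNneq => /rowP/(_ 0); rewrite mk2E mxE => ->. Qed.

Lemma mk2_neq0r (a b : k) : b != 0 -> mk2 a b != 0 :> 'rV[k]_2.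
Proof. by apply: contraNneq => /rowP/(_ 1); rewrite mk2E mxE => ->. Qed.

Lemma inj_unitmx n (L : 'M[k]_n) : (forall w : 'rV_n, w *m L = 0 -> w = 0) ->
  L \in unitmx.
Proof.
move=> injL; rewrite -row_free_unit -kermx_eq0; apply/eqP/row_matrixP => i.
by rewrite row0; apply: injL; rewrite -row_mul mulmx_ker row0.
Qed.

Lemma mulmx_unit_eq0 n m (w : 'M[k]_(m, n)) (L : 'M[k]_n) : L \in unitmx ->
  (w *m L == 0) = (w == 0).
Proof.
move=> uL; apply/eqP/eqP => [e|->]; last by rewrite mul0mx.
by rewrite -(mulmxK uL w) e mul0mx.
Qed.

Lemma wedge_unit w v (L : 'M[k]_2) : L \in unitmx -> wedge w v != 0 ->
  wedge (w *m L) (v *m L) != 0.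
Proof.
move=> uL wv; have [w0 v0 _] := nu_generic_neq0 wv.
apply: contraNneq wv => /wedge_eq0; rewrite !mulmx_unit_eq0 // => /(_ w0 v0).
case=> c c0 e; apply/eqP/collinear_wedge; exists c => //.
by rewrite -(mulmxK uL v) e -scalemxAl mulmxK.
Qed.

End Geometry.

(** * Automorphisms preserve the singular plane *)

Section Maps.

Variable k : closedFieldType.
Implicit Types (x z : 'rV[k]_5) (V : 'rV[{poly k}]_5) (F : 'I_5 -> {mpoly k[5]}).

Definition img F x : 'rV[k]_5 := \row_j (F j).@[x 0].
Definition img_along F V : 'rV[{poly k}]_5 := \row_j along (F j) V.

Lemma pt_at_img t F V : pt_at t (img_along F V) = img F (pt_at t V).
Proof. by apply/rowP=> j; rewrite !mxE /horner_eval horner_along. Qed.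

Lemma crd_pt_at t V i : crd (pt_at t V) i = (crd V i).[t].
Proof. by rewrite /crd mxE. Qed.

Lemma cubic_pt_at t V : cubic (pt_at t V) = (cubic V).[t].
Proof. by rewrite /cubic !crd_pt_at !hornerE. Qed.

(** The degree d is positive, which can be obtained by multiplying F and h by a
    coordinate; Euler's identity is then available for F. *)
Definition represents (G : 'rV[k]_5 -> 'rV[k]_5 -> Prop) x d F
    (h : {mpoly k[5]}) :=
  [/\ (0 < d)%N, forall j, F j \is d.-homog, h.@[x 0] != 0 &
      forall z, z != 0 -> cubic z = 0 -> h.@[z 0] != 0 -> G z (img F z)].

(** A regular map from X to X, seen as a relation between representatives of
    points. *)
Record regmap (G : 'rV[k]_5 -> 'rV[k]_5 -> Prop) : Prop := RegMap {
  regmap_dom : forall x z, G x z ->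
    [/\ x != 0, cubic x = 0, z != 0 & cubic z = 0];
  regmap_total : forall x, x != 0 -> cubic x = 0 -> exists z, G x z;
  regmap_fun : forall x z x' z', G x z -> G x' z' ->
    collinear x x' -> collinear z z';
  regmap_collinear : forall x z x' z', G x z ->
    collinear x x' -> collinear z z' -> G x' z';
  regmap_local : forall x, x != 0 -> cubic x = 0 ->
    exists d F h, represents G x d F h }.

Lemma represents_curve G x d F h V t0 : represents G x d F h -> x != 0 ->
    pt_at t0 V = x -> cubic V = 0 ->
  exists2 e : {poly k}, e.[t0] != 0 &
    forall t, e.[t] != 0 -> G (pt_at t V) (pt_at t (img_along F V)).
Proof.
case=> _ _ hx hG x0 V0 cV.
have [i xi] := rV0Pn _ x0.
exists (along h V * V 0 i).
  by rewrite hornerM horner_along V0 mulf_neq0 //; rewrite -V0 mxE in xi.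
move=> t; rewrite hornerM mulf_eq0 negb_or horner_along => /andP[ht Vt].
rewrite pt_at_img; apply: hG => //; last by rewrite cubic_pt_at cV horner0.
by apply: contraNneq Vt => /rowP/(_ i); rewrite !mxE => /eqP.
Qed.

Definition velocity n (V : 'rV[{poly k}]_n) : 'rV[k]_n := \row_i (V 0 i)`_1.

Lemma jacobian F x : exists J : 'M[k]_5, forall V, pt_at 0 V = x ->
  velocity (img_along F V) = velocity V *m J.
Proof.
have [c hc] := fin_all_exists (fun j => gradient (F j) x).
exists (\matrix_(i, j) c j 0 i) => V /hc e; apply/rowP=> j.
by rewrite !mxE e; apply: eq_bigr => i _; rewrite !mxE mulrC.
Qed.

Lemma velocity_ray n (x z : 'rV[k]_n) : velocity (ray x z) = z.
Proof. by apply/rowP=> i; rewrite !mxE coefD coefC mulrC coefMX coefC add0r. Qed.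

Lemma pt_at_ray0 n (x z : 'rV[k]_n) : pt_at 0 (ray x z) = x.
Proof. by rewrite pt_at_ray scale0r addr0. Qed.

Lemma ray_cubic x z : (forall t, cubic (x + t *: z) = 0) ->
  cubic (ray x z) = 0.
Proof.
move=> c; apply: (@poly_eq0_generic k 1); first exact: oner_neq0.
by move=> t _; rewrite -cubic_pt_at pt_at_ray.
Qed.

(** The tangent space of X at a general point of the singular plane is the
    whole space: X contains that plane and two other ones, and the three
    together span. *)
Lemma tangent_span (w y : 'rV[k]_2) (P : 'rV[k]_5 -> Prop) :
    wedge w y != 0 -> (forall x z, P x -> P z -> P (x + z)) ->
    (forall z, (forall t, cubic (nu w y 0 + t *: z) = 0) -> P z) ->
  forall z, P z.
Proof.
move=> wy PD Pz z.
pose a := (crd z 3 * y 0 1 - crd z 4 * y 0 0) / wedge w y.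
pose b := (w 0 0 * crd z 4 - w 0 1 * crd z 3) / wedge w y.
have -> : z = (z - nu w 0 a - nu y 0 b) + (nu w 0 a + nu y 0 b).
  by rewrite [nu w 0 a + _]addrC addrA !subrK.
have crdN u i : crd (- u) i = - crd u i by rewrite /crd mxE.
apply: (PD); last apply: (PD); apply: Pz => t.
- rewrite /cubic !crdD !crdZ !crdD !crdN !nuE.
  have -> : crd z 3 - a * w 0 0 - b * y 0 0 = 0.
    by rewrite /a /b; move: wy; rewrite /wedge => wy; field.
  have -> : crd z 4 - a * w 0 1 - b * y 0 1 = 0.
    by rewrite /a /b; move: wy; rewrite /wedge => wy; field.
  by ring.
- by rewrite -nuZr scaler0 -nuDr cubic_nu.
- by rewrite nu_sym -nuZr scaler0 -nuDr cubic_nu.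
Qed.

Section Automorphism.

Hypothesis chark : [pchar k] =i pred0.

Variables G H : 'rV[k]_5 -> 'rV[k]_5 -> Prop.
Hypotheses (regG : regmap G) (regH : regmap H).
Hypothesis GH : forall x z, G x z <-> H z x.

Lemma regmap_inj x z x' z' : G x z -> G x' z' -> collinear z z' -> collinear x x'.
Proof. by move=> /GH hx /GH hx'; apply: (regmap_fun regH) hx hx'. Qed.

(** Differentiating H o G = id at a point whose tangent space is everything
    shows that the Jacobian matrix of any representation of G kills at most the
    direction of the point itself, and by Euler's identity not even that. *)
Lemma jacobian_inj w y d F h (J : 'M[k]_5) : wedge w y != 0 ->
    represents G (nu w y 0) d F h ->
    (forall V, pt_at 0 V = nu w y 0 ->
       velocity (img_along F V) = velocity V *m J) ->
  forall z, z *m J = 0 -> z = 0.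
Proof.
set q := nu w y 0 => wy Grep hJ z zJ.
have [w0 y0 q0] := nu_generic_neq0 wy.
have cq : cubic q = 0 by apply: cubic_nu.
have Gq : G q (img F q) by case: Grep => _ _ hq; apply.
have [_ _ r0 cr] := regmap_dom regG Gq; set r := img F q in r0 cr Gq.
have [d' [F' [h' Hrep]]] := regmap_local regH r0 cr.
have [J' hJ'] := jacobian F' r.
have Hr : H r (img F' r) by case: (Hrep) => _ _ hr; apply.
have [l l0 rE] : collinear q (img F' r).
  by move/GH: Gq => Hq; apply: (regmap_fun regH) Hq Hr (collinear_refl r).
have T z1 : forall i j, (z1 *m J *m J') 0 i * q 0 j + l * q 0 i * z1 0 j =
      (z1 *m J *m J') 0 j * q 0 i + l * q 0 j * z1 0 i.
  move: z1; apply: (tangent_span wy) => [u v hu hv i j|v cv i j].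
    have addE (a b : 'rV[k]_5) m : (a + b) 0 m = a 0 m + b 0 m by rewrite mxE.
    rewrite !mulmxDl !addE !mulrDl !mulrDr addrACA hu hv; ring.
  pose V := ray q v; have V0 : pt_at 0 V = q by apply: pt_at_ray0.
  have cV : cubic V = 0 by apply: ray_cubic.
  have [e e0 GV] := represents_curve Grep q0 V0 cV.
  pose R := img_along F V; have R0 : pt_at 0 R = r by rewrite pt_at_img V0.
  have cR : cubic R = 0.
    apply: (@poly_eq0_generic k e).
      by apply: contraNneq e0 => ->; rewrite horner0.
    by move=> t /GV/(regmap_dom regG)[_ _ _]; rewrite cubic_pt_at.
  have [e' e'0 HR] := represents_curve Hrep r0 R0 cR.
  pose R' := img_along F' R.
  have eq : R' 0 i * V 0 j - R' 0 j * V 0 i = 0.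
    apply: (@poly_eq0_generic k (e * e')).
      apply: contraNneq (mulf_neq0 e0 e'0) => ee.
      by rewrite -hornerM ee horner0.
    move=> t; rewrite hornerM mulf_eq0 negb_or => /andP[/GV/GH Ht /HR Ht'].
    have [c c0 /rowP cE] := regmap_fun regH Ht Ht' (collinear_refl _).
    have Rt m : (R' 0 m).[t] = c * (V 0 m).[t].
      by have := cE m; rewrite -/R' [in RHS]mxE !pt_atE.
    by rewrite hornerD hornerN !hornerM !Rt; ring.
  have c0i i' : (R' 0 i')`_0 = l * q 0 i'.
    have /rowP/(_ i') : pt_at 0 R' = l *: q by rewrite pt_at_img R0 rE.
    by rewrite pt_atE horner_coef0 [in RHS]mxE.
  have c1i i' : (R' 0 i')`_1 = (v *m J *m J') 0 i'.
    rewrite -(velocity_ray q v) -/V -hJ // -hJ' //.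
    by rewrite [in RHS]mxE.
  have V0i i' : (V 0 i')`_0 = q 0 i'.
    by rewrite -V0 pt_atE horner_coef0.
  have V1i i' : (V 0 i')`_1 = v 0 i'.
    by rewrite -[v in RHS](velocity_ray q v) [in RHS]mxE.
  have := congr1 (fun p : {poly k} => p`_1) eq.
  rewrite /= coefB coef0 !coef1M !c0i !c1i !V0i !V1i => /eqP.
  by rewrite subr_eq0 => /eqP e1; rewrite addrC e1 addrC.
have Tz i j : q 0 i * z 0 j = q 0 j * z 0 i.
  have := T z i j; rewrite zJ mul0mx !mxE !mul0r !add0r -!mulrA.
  by move/(mulfI l0).
have [i qi] := rV0Pn _ q0.
have zE : z = (z 0 i / q 0 i) *: q.
  apply/rowP=> j; rewrite mxE; apply: (mulfI qi); rewrite Tz; field.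
  by rewrite qi.
set c := z 0 i / q 0 i in zE.
case: (Grep) => d0 Fd _ _.
have qJ : q *m J = d%:R *: r.
  rewrite -(velocity_ray q q) -hJ ?pt_at_ray0 //; apply/rowP=> j.
  have -> : ray q q = (1 + 'X) *: map_mx polyC q by rewrite scalerDl scale1r.
  by rewrite !mxE (along_homog _ _ (Fd j)) along_const coefMC coef1_exp.
have : (c * d%:R) *: r = 0 by rewrite -scalerA -qJ scalemxAl -zE.
move/eqP; rewrite scaler_eq0 (negPf r0) orbF mulf_eq0 => /orP[/eqP c0|].
  by rewrite zE c0 scale0r.
by rewrite ((pcharf0P k).1 chark) -leqn0 leqNgt d0.
Qed.

(** The singular plane: at a general point of it the Jacobian matrix is
    invertible, so the image cannot be a point where the tangent space of X is
    a hyperplane. *)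
Lemma plane_image_generic w y z : wedge w y != 0 -> G (nu w y 0) z ->
  crd z 3 = 0 /\ crd z 4 = 0.
Proof.
move=> wy Gz; have [w0 y0 q0] := nu_generic_neq0 wy.
have cq : cubic (nu w y 0) = 0 := cubic_nu w y 0.
have [d [F [h Grep]]] := regmap_local regG q0 cq.
set q := nu w y 0 in q0 cq Gz Grep.
have Gq : G q (img F q) by case: Grep => _ _ hq; apply.
have [J hJ] := jacobian F q.
have Jinj := jacobian_inj wy Grep hJ.
set r := img F q in Gq.
suff [r3 r4] : crd r 3 = 0 /\ crd r 4 = 0.
  have [c _ ->] := regmap_fun regG Gq Gz (collinear_refl _).
  by rewrite !crdZ r3 r4 !mulr0.
pose D (u : 'rV[k]_5) := crd u 0 * crd r 3 ^+ 2 +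
   crd r 0 * (crd r 3 * crd u 3 *+ 2) + crd u 1 * crd r 3 * crd r 4 +
   crd r 1 * (crd r 3 * crd u 4 + crd u 3 * crd r 4) +
   crd u 2 * crd r 4 ^+ 2 + crd r 2 * (crd r 4 * crd u 4 *+ 2).
have DJ u : D (u *m J) = 0.
  move: u; apply: (tangent_span wy) => [u v hu hv|v cv].
    have : D (u *m J) + D (v *m J) = 0 by rewrite hu hv addr0.
    by rewrite mulmxDl /D !crdD => e; rewrite -[RHS]e; ring.
  pose V := ray q v; have V0 : pt_at 0 V = q by apply: pt_at_ray0.
  have cV : cubic V = 0 by apply: ray_cubic.
  have [e e0 GV] := represents_curve Grep q0 V0 cV.
  pose R := img_along F V; have R0 : pt_at 0 R = r by rewrite pt_at_img V0.
  have cR : cubic R = 0.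
    apply: (@poly_eq0_generic k e).
      by apply: contraNneq e0 => ->; rewrite horner0.
    by move=> t /GV/(regmap_dom regG)[_ _ _]; rewrite cubic_pt_at.
  have := congr1 (fun p : {poly k} => p`_1) cR.
  have -> : v *m J = velocity R by rewrite hJ // velocity_ray.
  have Rc i : (crd R i)`_0 = crd r i.
    by rewrite -R0 crd_pt_at horner_coef0.
  have Rd i : (crd R i)`_1 = crd (velocity R) i by rewrite /crd [RHS]mxE.
  rewrite /cubic coef0 !coefD !expr2 !coef1M -!horner_coef0 !hornerM.
  by rewrite !horner_coef0 !Rc !Rd /D => e1; rewrite -[RHS]e1; ring.
have Junit : J \in unitmx by apply: inj_unitmx.
have D0 u : D u = 0 by rewrite -(mulmxKV Junit u) DJ.
have dE (i j : nat) : (i < 5)%N -> (j < 5)%N ->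
    crd (delta_mx 0 (inord i) : 'rV[k]_5) j = (i == j)%:R.
  move=> i5 j5; rewrite /crd mxE eqxx /=; congr (_%:R); congr nat_of_bool.
  by rewrite -val_eqE /= !inordK // eq_sym.
split; apply/eqP; rewrite -sqrf_eq0.
  rewrite -(D0 (delta_mx 0 (inord 0))) /D !dE //=; apply/eqP; ring.
rewrite -(D0 (delta_mx 0 (inord 2))) /D !dE //=; apply/eqP; ring.
Qed.

(** The points of the singular plane left out lie on the conic wedge w y = 0;
    they are limits of general ones along lines of the plane. *)
Lemma plane_image x z : G x z -> crd x 3 = 0 -> crd x 4 = 0 ->
  crd z 3 = 0 /\ crd z 4 = 0.
Proof.
move=> Gx x3 x4; have [x0 cx _ _] := regmap_dom regG Gx.
have [d [F [h Grep]]] := regmap_local regG x0 cx.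
have [w [y [w0 xE]]] := plane_split x3 x4.
have y0 : y != 0.
  apply: contraNneq x0 => y0; rewrite xE y0.
  by rewrite -(scale0r 0) -[0 in X in nu _ _ X](mul0r 0) nuZr scale0r.
(* a direction that leaves the conic wedge w y = 0 *)
have [v wv] : exists v, wedge w v != 0.
  case/row2_neq0/orP: w0 => h0.
    by exists (mk2 0 1); rewrite /wedge !mk2E mulr1 mulr0 subr0.
  by exists (mk2 1 0); rewrite /wedge !mk2E mulr0 mulr1 sub0r oppr_eq0.
pose V := ray x (nu w v 0); have V0 : pt_at 0 V = x by apply: pt_at_ray0.
have VE t : pt_at t V = nu w (y + t *: v) 0.
  by rewrite pt_at_ray xE -nuZr mulr0 -nuDr addr0.
have cV : cubic V = 0.
  by apply: ray_cubic => t; rewrite -pt_at_ray -/V VE cubic_nu.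
have [e e0 GV] := represents_curve Grep x0 V0 cV.
pose R := img_along F V.
pose e' : {poly k} := e * ((wedge w y)%:P + (wedge w v) *: 'X).
have e'0 : e' != 0.
  rewrite mulf_neq0 //; first by apply: contraNneq e0 => ->; rewrite horner0.
  apply: contraNneq wv => /(congr1 (fun p : {poly k} => p`_1)).
  by rewrite coefD coefC coefZ coefX mulr1 add0r coef0 => ->.
have RS : crd R 3 = 0 /\ crd R 4 = 0.
  suff H0 t : e'.[t] != 0 -> crd (pt_at t R) 3 = 0 /\ crd (pt_at t R) 4 = 0.
    by split; apply: (poly_eq0_generic e'0) => t /H0[]; rewrite !crd_pt_at.
  rewrite /e' hornerM mulf_eq0 negb_or !hornerE => /andP[/GV Ge ht].
  apply: (plane_image_generic (y := y + t *: v) (w := w)); last by rewrite -VE.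
  rewrite (_ : wedge _ _ = wedge w y + wedge w v * t) //.
  by rewrite /wedge !mxE; ring.
have := GV 0 e0; rewrite V0 => G0.
have [c _ ->] := regmap_fun regG G0 Gx (collinear_refl _).
by rewrite !crdZ !crd_pt_at; case: RS => -> ->; rewrite horner0 mulr0.
Qed.

End Automorphism.
End Maps.

(** * Degrees and limits of polynomial curves *)

Section Limits.

Variable k : closedFieldType.

Definition bounded n (e : nat) (V : 'rV[{poly k}]_n) :=
  forall i, (size (V 0%R i) <= e.+1)%N.

(** When [e] bounds the degrees, this is the point at infinity of the curve. *)
Definition top n (e : nat) (V : 'rV[{poly k}]_n) : 'rV[k]_n :=
  map_mx (coefp e) V.

Lemma topE n e (V : 'rV[{poly k}]_n) i : top e V 0 i = (V 0 i)`_e.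
Proof. by rewrite mxE. Qed.

Lemma degree_exists n (V : 'rV[{poly k}]_n) : V != 0 ->
  exists2 e, bounded e V & top e V != 0.
Proof.
move=> /rV0Pn[i0 Vi0].
case: (@arg_maxnP _ i0 xpredT (fun i => size (V 0 i)) isT) => i _ max_i.
have hi j : (size (V 0%R j) <= size (V 0%R i))%N by apply: max_i.
have Vi : V 0 i != 0.
  by rewrite -size_poly_gt0 (leq_trans _ (hi i0)) ?size_poly_gt0.
exists (size (V 0 i)).-1.
  by move=> j; rewrite prednK ?size_poly_gt0 // hi.
by apply/rV0Pn; exists i; rewrite topE -lead_coefE lead_coef_eq0.
Qed.

Lemma unimodular_neq0 n (V : 'rV[{poly k}]_n) : unimodular V -> V != 0.
Proof.
move=> /(unimodular_at 0); apply: contraNneq => ->.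
by rewrite /pt_at map_mx0.
Qed.

Lemma coef_mul_top (a b : {poly k}) m n : (size a <= m.+1)%N ->
  (size b <= n.+1)%N -> (a * b)`_(m + n) = a`_m * b`_n.
Proof.
move=> ha hb; rewrite coefM.
have hm : (m < (m + n).+1)%N by rewrite ltnS leq_addr.
rewrite (bigD1 (Ordinal hm)) //= addKn big1 ?addr0 // => i.
rewrite -val_eqE /= => im; have [lt|ge] := ltnP m i.
  by rewrite nth_default ?mul0r // (leq_trans ha).
rewrite [X in _ * X]nth_default ?mulr0 // (leq_trans hb) //; lia.
Qed.

Lemma size_mul_top (a b : {poly k}) m n : (size a <= m.+1)%N ->
  (size b <= n.+1)%N -> (size (a * b)%R <= (m + n).+1)%N.
Proof.
by move=> ha hb; apply: leq_trans (size_polyMleq _ _) _; lia.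
Qed.

Lemma top_crd e (V : 'rV[{poly k}]_5) i : crd (top e V) i = (crd V i)`_e.
Proof. by rewrite /crd mxE. Qed.

Lemma top_nu m n (z a : 'rV[{poly k}]_2) (c : {poly k}) :
    bounded m z -> bounded n a ->
    (size c <= n.+1)%N ->
  top (m + n) (nu z a c) = nu (top m z) (top n a) (c`_n).
Proof.
move=> hz ha hc; apply: crd_inj; rewrite top_crd !nuE !topE;
  by rewrite ?coefN ?coefD [(m + n)%N]addnC !coef_mul_top.
Qed.

Lemma bounded_nu m n (z a : 'rV[{poly k}]_2) (c : {poly k}) :
    bounded m z -> bounded n a ->
  (size c <= n.+1)%N -> bounded (m + n) (nu z a c).
Proof.
move=> hz ha hc i; rewrite -[i]inord_val -/(crd _ _) [(m + n)%N]addnC.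
case: i => -[|[|[|[|[|//]]]]] ? /=; rewrite nuE ?size_polyN.
- exact: size_mul_top.
- by rewrite (leq_trans (size_polyD _ _)) // geq_max !size_mul_top.
- exact: size_mul_top.
- exact: size_mul_top.
- exact: size_mul_top.
Qed.

Lemma pt_at_nu t (z a : 'rV[{poly k}]_2) (c : {poly k}) :
  pt_at t (nu z a c) = nu (pt_at t z) (pt_at t a) c.[t].
Proof. exact: map_nu. Qed.

(** T ^ e * a(1 / T), which gives the curve near its point at infinity. *)
Definition revp e (a : {poly k}) : {poly k} := \poly_(j < e.+1) a`_(e - j).

Lemma horner_revp e (a : {poly k}) t : t != 0 -> (size a <= e.+1)%N ->
  (revp e a).[t] = t ^+ e * a.[t^-1].
Proof.
move=> t0 ha; rewrite horner_poly (horner_coef_wide _ ha) mulr_sumr.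
rewrite (reindex_inj rev_ord_inj) /=; apply: eq_bigr => i _.
have ie : (i <= e)%N by rewrite -ltnS.
rewrite subSS subKn // mulrCA; congr (_ * _).
by rewrite expfB_cond ?(negPf t0) ?exprVn.
Qed.

Lemma horner_revp0 e (a : {poly k}) : (revp e a).[0] = a`_e.
Proof. by rewrite horner_coef0 coef_poly subn0. Qed.

Lemma revp_unimodular n e (V : 'rV[{poly k}]_n) : unimodular V -> bounded e V ->
  top e V != 0 -> unimodular (map_mx (revp e) V).
Proof.
move=> uV bV tV; apply: unimodularP => t; have [->|t0] := eqVneq t 0.
  apply: contraNneq tV => /rowP E; apply/eqP/rowP => i.
  by have := E i; rewrite topE !mxE /horner_eval horner_revp0.
apply: contraNneq (unimodular_at t^-1 uV) => /rowP E; apply/eqP/rowP => i.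
have := E i; rewrite !mxE /horner_eval horner_revp // => /eqP.
by rewrite mulf_eq0 expf_eq0 (negPf t0) andbF => /eqP.
Qed.

Lemma pt_at_mk2 t (a b : {poly k}) : pt_at t (mk2 a b) = mk2 a.[t] b.[t].
Proof. by apply: row2_eq; rewrite pt_atE !mk2E. Qed.

Lemma size_quotient (a b : {poly k}) e : (size (a * b)%R <= e.+1)%N ->
  b`_e != 0 -> (size a <= 1)%N.
Proof.
move=> sab be; have [->|a0] := eqVneq a 0; first by rewrite size_poly0.
have b0 : b != 0 by apply: contraNneq be => ->; rewrite coef0.
have sb : (e < size b)%N.
  by rewrite ltnNge; apply: contraNN be => se; rewrite nth_default.
have sa : (0 < size a)%N by rewrite size_poly_gt0.
rewrite size_mul // in sab; rewrite -(leq_add2r e.+1).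
rewrite (leq_trans (leq_add (leqnn _) sb)) //.
by move: sab; case: (size a) sa => // m _; rewrite addSn.
Qed.

Lemma size1_const n (V : 'rV[{poly k}]_n) : bounded 0 V ->
  V = map_mx polyC (pt_at 0 V).
Proof.
move=> bV; apply/rowP => i; rewrite !mxE /horner_eval horner_coef0.
exact: size1_polyC.
Qed.

Lemma pt_at_const n t (x : 'rV[k]_n) : pt_at t (map_mx polyC x) = x.
Proof. by apply/rowP => i; rewrite !mxE /horner_eval hornerC. Qed.

Lemma lift_curve (P : 'rV[{poly k}]_5) : unimodular P -> cubic P = 0 ->
    (forall t, mk2 (crd P 3).[t] (crd P 4).[t] != 0) ->
  exists z a, unimodular z /\ P = nu z a 1.
Proof.
move=> uP cP nz; pose z := mk2 (crd P 3) (crd P 4).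
have uz : unimodular z.
  by apply: unimodularP => t; rewrite pt_at_mk2.
have [S SE] := uz; move: SE; rewrite !big_ord_recl big_ord0 addr0.
rewrite [lift _ _](_ : _ = 1); last exact: val_inj.
rewrite !mk2E => /(nu_lift cP)[a aE].
by exists z, a.
Qed.

Lemma wedge_pt_at t (z z' : 'rV[{poly k}]_2) :
  (wedge z z').[t] = wedge (pt_at t z) (pt_at t z').
Proof. by rewrite /wedge !pt_atE !hornerE. Qed.

Lemma top_wedge m n (z z' : 'rV[{poly k}]_2) : bounded m z -> bounded n z' ->
  (wedge z z')`_(m + n) = wedge (top m z) (top n z').
Proof. by move=> bz bz'; rewrite /wedge coefB !coef_mul_top // !topE. Qed.

Lemma nu_curve_unimodular (z a : 'rV[{poly k}]_2) : unimodular z ->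
  unimodular (nu z a 1).
Proof.
move=> uz; apply: unimodularP => t; rewrite pt_at_nu hornerC nu_neq01 //.
exact: unimodular_at.
Qed.

(** The degree n of the curve with homogeneous coordinates (a, 1), and its point
    at infinity. *)
Lemma affine_degree (a : 'rV[{poly k}]_2) : exists2 n, bounded n a &
  (top n a != 0) || ((1 : {poly k})`_n != 0).
Proof.
have [->|a0] := eqVneq a 0.
  by exists 0%N => [i|]; rewrite ?mxE ?size_poly0 // coef1 oner_neq0 orbT.
by have [n bn tn] := degree_exists a0; exists n; rewrite ?tn.
Qed.

Lemma line_eq (w o v : 'rV[k]_2) t :
  nu w o 1 + t *: nu w v 0 = nu w (o + t *: v) 1.
Proof. by rewrite -nuZr mulr0 -nuDr addr0. Qed.

Lemma line_rev_eq (w o v : 'rV[k]_2) t :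
  nu w v 0 + t *: nu w o 1 = nu w (v + t *: o) t.
Proof. by rewrite -nuZr mulr1 -nuDr add0r. Qed.

Lemma line_rev_cubic (w o v : 'rV[k]_2) : cubic (ray (nu w v 0) (nu w o 1)) = 0.
Proof. by apply: ray_cubic => t; rewrite line_rev_eq cubic_nu. Qed.

Variable G : 'rV[k]_5 -> 'rV[k]_5 -> Prop.
Hypothesis regG : regmap G.

(** Any representation of G becomes coprime after division by the greatest
    common divisor of its coordinates on the line, and is then valid on the
    whole line: a representation valid near another point is a multiple of
    it. *)
Lemma line_image p q : (forall t, p + t *: q != 0) -> cubic (ray p q) = 0 ->
  exists2 P, unimodular P & forall t, G (p + t *: q) (pt_at t P).
Proof.
move=> nz cV; set V := ray p q in cV.
have Vt t : pt_at t V = p + t *: q by apply: pt_at_ray.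
have cVt t : cubic (p + t *: q) = 0 by rewrite -Vt cubic_pt_at cV horner0.
have local t0 : exists R (e : {poly k}), [/\ e.[t0] != 0, pt_at t0 R != 0 &
    forall t, e.[t] != 0 -> G (p + t *: q) (pt_at t R)].
  have [d [F [h Grep]]] := regmap_local regG (nz t0) (cVt t0).
  have [e et0 he] := represents_curve Grep (nz t0) (Vt t0) cV.
  exists (img_along F V), e; split=> // [|t /he]; last by rewrite Vt.
  by have [] := regmap_dom regG (he _ et0).
have [R [e [e0 R0 GR]]] := local 0.
have Rn0 : R != 0 by apply: contraNneq R0 => ->; rewrite /pt_at map_mx0.
have [d [W [d0 RE uW]]] := tuple_primitive Rn0.
exists W => // t0; have [R' [e' [e't0 R'0 GR']]] := local t0.
have [C CE] : exists C, R' = C *: W.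
  apply: (unimodular_factor (h := e * e' * d)) => // [|t].
    rewrite !mulf_neq0 //; first by apply: contraNneq e0 => ->; rewrite horner0.
    by apply: contraNneq e't0 => ->; rewrite horner0.
  rewrite !hornerM !mulf_eq0 !negb_or => /andP[/andP[/GR h /GR' h'] dt].
  apply: collinear_trans (regmap_fun regG h h' (collinear_refl _)).
  exists d.[t] => //; apply/rowP => i.
  by rewrite RE !mxE /horner_eval hornerM.
have R'E : pt_at t0 R' = C.[t0] *: pt_at t0 W.
  by apply/rowP => i; rewrite CE !mxE /horner_eval hornerM.
have Ct0 : C.[t0] != 0.
  by apply: contraNneq R'0 => c0; rewrite R'E c0 scale0r.
apply: (regmap_collinear regG (GR' _ e't0) (collinear_refl _)).
by apply: collinear_sym; exists C.[t0].
Qed.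

(** The point at infinity of a line: after clearing the common factor, any
    representation of G near q is the reversed curve. *)
Lemma line_limit_factor p q P e d F h : q != 0 -> cubic (ray q p) = 0 ->
    unimodular P -> (forall t, G (p + t *: q) (pt_at t P)) ->
    bounded e P -> top e P != 0 -> represents G q d F h ->
  exists C, img_along F (ray q p) = C *: map_mx (revp e) P.
Proof.
move=> q0 cV uP GP bP tP Grep.
have [g g0 hg] := represents_curve Grep q0 (pt_at_ray0 q p) cV.
apply: (unimodular_factor (h := g * 'X)); last exact: revp_unimodular.
  rewrite mulf_neq0 ?polyX_eq0 //.
  by apply: contraNneq g0 => ->; rewrite horner0.
move=> t; rewrite hornerM hornerX mulf_eq0 negb_or => /andP[/hg Gt t0].
have H : pt_at t (map_mx (revp e) P) = t ^+ e *: pt_at t^-1 P.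
  by apply/rowP => i; rewrite !mxE /horner_eval horner_revp.
rewrite H; apply: collinear_trans (regmap_fun regG (GP t^-1) Gt _).
  apply: collinear_sym; exists (t ^+ e); by rewrite ?expf_neq0.
by exists t => //; rewrite pt_at_ray scalerDr scalerA divff // scale1r addrC.
Qed.

Lemma line_limit p q P e : q != 0 -> cubic (ray q p) = 0 ->
    unimodular P -> (forall t, G (p + t *: q) (pt_at t P)) ->
    bounded e P -> top e P != 0 -> G q (top e P).
Proof.
move=> q0 cV uP GP bP tP; have cq : cubic q = 0.
  by rewrite -(pt_at_ray0 q p) cubic_pt_at cV horner0.
have [d [F [h Grep]]] := regmap_local regG q0 cq.
have [C CE] := line_limit_factor q0 cV uP GP bP tP Grep.
have Gq : G q (img F q) by case: Grep => _ _ hq; apply.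
have E : img F q = C.[0] *: top e P.
  rewrite -{1}(pt_at_ray0 q p) -pt_at_img CE; apply/rowP => i.
  by rewrite !mxE /horner_eval hornerM horner_revp0.
apply: (regmap_collinear regG Gq (collinear_refl _)); apply: collinear_sym.
exists C.[0] => //.
have [_ _ + _] := regmap_dom regG Gq.
by apply: contraNneq => c0; rewrite E c0 scale0r.
Qed.

End Limits.

(** * Automorphisms of X are linear in the parametrization *)

Section Structure.

Variable k : closedFieldType.
Hypothesis chark : [pchar k] =i pred0.

Variables G H : 'rV[k]_5 -> 'rV[k]_5 -> Prop.
Hypotheses (regG : regmap G) (regH : regmap H).
Hypothesis GH : forall x z, G x z <-> H z x.

Implicit Types (w y v o : 'rV[k]_2).

Lemma natS_neq0 n : ((n.+1)%:R : k) != 0.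
Proof. by rewrite ((pcharf0P k).1 chark). Qed.

Lemma card_neq0 (gT : finGroupType) : (#|gT|%:R : k) != 0.
Proof.
have : (0 < #|gT|)%N by apply/card_gt0P; exists 1%g.
by case: #|gT| => // m _; apply: natS_neq0.
Qed.

Lemma image_off_plane w y z : w != 0 -> G (nu w y 1) z ->
  mk2 (crd z 3) (crd z 4) != 0.
Proof.
move=> w0 Gz; apply/eqP => /rowP E.
have [e3 e4] : crd z 3 = 0 /\ crd z 4 = 0.
  by have := (E 0, E 1); rewrite !mk2E !mxE => -[].
have [] := plane_image chark regH regG (fun x x1 => iff_sym (GH x1 x))
  ((GH _ _).1 Gz) e3 e4.
rewrite !nuE !mul1r => w3 w4; case/eqP: w0.
by apply: row2_eq; rewrite mxE.
Qed.

(** The line over a fixed y goes to a curve that avoids the singular plane, on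
    which y is a regular function with values in the affine plane; such a
    function on a projective line is constant. *)
Lemma fiber_image y : exists z e b, [/\ unimodular z, bounded e z, top e z != 0,
  forall t, G (nu (mk2 1 t) y 1) (nu (pt_at t z) b 1) &
  G (nu (mk2 0 1) y 1) (nu (top e z) b 1)].
Proof.
pose p := nu (mk2 1 0) y 1 : 'rV[k]_5; pose q := nu (mk2 0 1) y 1 : 'rV[k]_5.
have pq t : p + t *: q = nu (mk2 1 t) y 1.
  rewrite /p /q -nuZl -nuDl; congr nu.
  by apply: row2_eq; rewrite !mxE /=; ring.
have qp t : q + t *: p = nu (mk2 t 1) y 1.
  rewrite /p /q -nuZl -nuDl; congr nu.
  by apply: row2_eq; rewrite !mxE /=; ring.
have w0 t : mk2 1 t != 0 :> 'rV[k]_2 by apply: mk2_neq0l; apply: oner_neq0.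
have w1 t : mk2 t 1 != 0 :> 'rV[k]_2 by apply: mk2_neq0r; apply: oner_neq0.
have [||P uP GP] := line_image regG (p := p) (q := q).
- by move=> t; rewrite pq nu_neq01.
- by apply: ray_cubic => t; rewrite pq cubic_nu.
have cP : cubic P = 0.
  apply: (@poly_eq0_generic k 1); first exact: oner_neq0.
  by move=> t _; rewrite -cubic_pt_at; have [] := regmap_dom regG (GP t).
have off t : mk2 (crd P 3).[t] (crd P 4).[t] != 0.
  by rewrite -!crd_pt_at (image_off_plane (w0 t) (y := y)) // -pq.
have [z [a [uz PE]]] := lift_curve uP cP off.
have [e bP tP] := degree_exists (unimodular_neq0 uP).
have Gq : G q (top e P).
  apply: (line_limit regG _ _ uP GP bP tP); first exact: nu_neq01.
  by apply: ray_cubic => t; rewrite qp cubic_nu.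
have sc i : (size (crd P i) <= e.+1)%N by apply: bP.
have bz : bounded e z.
  apply: ord2_ind; first by have := sc 3; rewrite PE nuE mul1r.
  by have := sc 4; rewrite PE nuE mul1r.
have tz : top e z != 0.
  have := image_off_plane (w1 0) Gq; rewrite !top_crd PE !nuE !mul1r.
  by rewrite (_ : mk2 _ _ = top e z) //; apply: row2_eq; rewrite mk2E topE.
have ba : bounded 0 a.
  have P0 : (size (a 0 1 * z 0 1)%R <= e.+1)%N by have := sc 0; rewrite PE nuE.
  have P2 : (size (a 0 0 * z 0 0)%R <= e.+1)%N by have := sc 2; rewrite PE nuE.
  have P1 : (size (a 0 0 * z 0 1 + a 0 1 * z 0 0)%R <= e.+1)%N.
    by have := sc 1; rewrite PE nuE size_polyN.
  have const_mul (u : {poly k}) i :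
      (size u <= 1)%N -> (size (u * z 0 i)%R <= e.+1)%N.
    by move=> su; apply: (@size_mul_top k u _ 0 e) => //; apply: bz.
  have [a0 a1] : (size (a 0%R 0%R) <= 1)%N /\ (size (a 0%R 1%R) <= 1)%N.
    case/row2_neq0/orP: tz; rewrite topE => ze.
      have s0 := size_quotient P2 ze; split=> //; apply: size_quotient ze.
      have -> : a 0 1 * z 0 0 =
        (a 0 0 * z 0 1 + a 0 1 * z 0 0) - a 0 0 * z 0 1 by ring.
      rewrite (leq_trans (size_polyD _ _)) // geq_max P1 size_polyN.
      exact: const_mul.
    have s1 := size_quotient P0 ze; split=> //; apply: size_quotient ze.
    have -> : a 0 0 * z 0 1 =
      (a 0 0 * z 0 1 + a 0 1 * z 0 0) - a 0 1 * z 0 0 by ring.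
    rewrite (leq_trans (size_polyD _ _)) // geq_max P1 size_polyN.
    exact: const_mul.
  exact: ord2_ind.
exists z, e, (pt_at 0 a); split=> //.
  move=> t; have := GP t; rewrite pq PE pt_at_nu hornerC.
  by rewrite {1}(size1_const ba) pt_at_const.
have := Gq; rewrite PE -[e]addn0 top_nu ?size_poly1 // addn0.
rewrite coefC /=; congr (G _ (nu _ _ _)).
by apply/rowP => i; rewrite topE pt_atE horner_coef0.
Qed.

Lemma fiber_const y : exists b, forall w, w != 0 ->
  exists2 w', w' != 0 & G (nu w y 1) (nu w' b 1).
Proof.
have [z [e [b [uz _ tz Gt Gtop]]]] := fiber_image y.
exists b => w w0; have [w1|w1] := eqVneq (w 0 0) 0.
  exists (top e z) => //; apply: (regmap_collinear regG Gtop) (collinear_refl _).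
  exists (w 0 1); first by case/row2_neq0/orP: w0; rewrite ?w1 ?eqxx.
  by rewrite -nuZl; congr nu; apply: row2_eq; rewrite !mxE /= ?w1; ring.
exists (pt_at (w 0 1 / w 0 0) z); first exact: unimodular_at.
apply: (regmap_collinear regG (Gt _) _ (collinear_refl _)).
exists (w 0 0) => //; rewrite -nuZl; congr nu.
by apply: row2_eq; rewrite !mxE /= ?mulr1 // mulrC divfK.
Qed.

Lemma plane_line_image w o v : w != 0 -> exists z a, unimodular z /\
  forall t, G (nu w (o + t *: v) 1) (nu (pt_at t z) (pt_at t a) 1).
Proof.
move=> w0; have [||P uP GP] :=
    line_image regG (p := nu w o 1) (q := nu w v 0).
- by move=> t; rewrite line_eq nu_neq01.
- by apply: ray_cubic => t; rewrite line_eq cubic_nu.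
have cP : cubic P = 0.
  apply: (@poly_eq0_generic k 1); first exact: oner_neq0.
  by move=> t _; rewrite -cubic_pt_at; have [] := regmap_dom regG (GP t).
have [t|z [a [uz PE]]] := lift_curve uP cP.
  have := GP t; rewrite line_eq => Gt.
  by rewrite -!crd_pt_at (image_off_plane w0 Gt).
exists z, a; split=> // t; have := GP t.
by rewrite line_eq PE pt_at_nu hornerC.
Qed.

Lemma plane_line_limit w o v m n (z a : 'rV[{poly k}]_2) :
    w != 0 -> v != 0 -> unimodular z ->
    (forall t, G (nu w (o + t *: v) 1) (nu (pt_at t z) (pt_at t a) 1)) ->
    bounded m z -> top m z != 0 -> bounded n a ->
    (top n a != 0) || ((1 : {poly k})`_n != 0) ->
  G (nu w v 0) (nu (top m z) (top n a) (1 : {poly k})`_n).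
Proof.
move=> w0 v0 uz Gt bz tz ba ta; rewrite -top_nu ?size_poly1 //.
apply: (line_limit regG (p := nu w o 1)).
- by rewrite nu_neq0 ?v0.
- exact: line_rev_cubic.
- exact: nu_curve_unimodular.
- by move=> t; rewrite line_eq pt_at_nu hornerC.
- by apply: bounded_nu; rewrite ?size_poly1.
- by rewrite top_nu ?size_poly1 // nu_neq0.
Qed.

(** Along an affine line of the plane over w, the point of P^1 below the image
    is given by coprime polynomials z. Over two points w1, w2 the determinant
    of z1 and z2 has no zeros, hence is constant; were z1 not constant, z1 and
    z2 would tend to the same limit, and so would the images of two points that
    remain distinct at infinity. *)
Lemma base_const_line w o v : w != 0 -> v != 0 -> exists2 w', w' != 0 &
  exists a, forall t, G (nu w (o + t *: v) 1) (nu w' (pt_at t a) 1).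
Proof.
move=> w0 v0; have [w2 ww2] := exists_noncollinear w0.
have w20 : w2 != 0.
  by apply: contraNneq ww2 => ->; rewrite /wedge !mxE; apply/eqP; ring.
have [z [a [uz Gz]]] := plane_line_image o v w0.
have [z2 [a2 [uz2 Gz2]]] := plane_line_image o v w20.
have aE t : pt_at t a2 = pt_at t a.
  have [b hb] := fiber_const (o + t *: v).
  have [u u0 Gu] := hb _ w0; have [u2 u20 Gu2] := hb _ w20.
  have [<- _] := nu_inj1 u0 (regmap_fun regG Gu (Gz t) (collinear_refl _)).
  by have [<- _] := nu_inj1 u20 (regmap_fun regG Gu2 (Gz2 t) (collinear_refl _)).
have {}Gz2 t : G (nu w2 (o + t *: v) 1) (nu (pt_at t z2) (pt_at t a) 1).
  by rewrite -aE.
have nd t : wedge (pt_at t z) (pt_at t z2) != 0.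
  apply: contraNneq ww2 => zz2.
  have /collinear_wedge -> // : collinear w w2.
  have [c c0 e] := wedge_eq0 (unimodular_at t uz) (unimodular_at t uz2) zz2.
  have := regmap_inj regH GH (Gz t) (Gz2 t).
  case/(_ _)/nu_inj1 => //; exists c => //.
  by rewrite e nuZl.
have sd : (size (wedge z z2) <= 1)%N.
  have [/eqP->//|/closed_rootP[t]] := boolP (size (wedge z z2) == 1%N).
  by rewrite rootE wedge_pt_at (negPf (nd t)).
have [m bz tz] := degree_exists (unimodular_neq0 uz).
have [m2 bz2 tz2] := degree_exists (unimodular_neq0 uz2).
have [m0|m0] := posnP m.
  move: bz; rewrite m0 => bz; exists (pt_at 0 z); first exact: unimodular_at.
  by exists a => t; have := Gz t; rewrite {1}(size1_const bz) pt_at_const.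
have /(wedge_eq0 tz tz2)[c c0 cE] : wedge (top m z) (top m2 z2) = 0.
  by rewrite -top_wedge // nth_default // (leq_trans sd) // addn_gt0 m0.
have [n ba ta] := affine_degree a.
have L := plane_line_limit w0 v0 uz Gz bz tz ba ta.
have L2 := plane_line_limit w20 v0 uz2 Gz2 bz2 tz2 ba ta.
have P : collinear (nu w v 0) (nu w2 v 0).
  by apply: (regmap_inj regH GH L L2); exists c => //; rewrite cE nuZl.
by case/eqP: ww2; apply/collinear_wedge/(nu_inj0 v0 P).
Qed.

Lemma base_const w : w != 0 -> exists2 w', w' != 0 &
  forall y, exists b, G (nu w y 1) (nu w' b 1).
Proof.
move=> w0; have [b0 /(_ _ w0)[w' w'0 G0]] := fiber_const 0.
exists w' => // y; have [->|y0] := eqVneq y 0; first by exists b0.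
have [w1 w10 [a Ga]] := base_const_line 0 w0 y0.
have := Ga 0; rewrite scale0r addr0 => Ga0.
have [_ P] := nu_inj1 w10 (regmap_fun regG Ga0 G0 (collinear_refl _)).
exists (pt_at 1 a); have := Ga 1; rewrite scale1r add0r => Ga1.
apply: (regmap_collinear regG Ga1 (collinear_refl _)).
by case: P => c c0 ->; exists c => //; rewrite nuZl.
Qed.

(** In characteristic zero an injective morphism from P^1 to itself has degree
    one: each fibre of a map z of degree e >= 2 would be a single point of
    multiplicity e, so z and its derivative would be proportional
    everywhere. *)
Lemma degree_one (z : 'rV[{poly k}]_2) e : unimodular z -> bounded e z ->
    top e z != 0 ->
    (forall s t, wedge (pt_at s z) (pt_at t z) = 0 -> s = t) ->
    (forall t, wedge (top e z) (pt_at t z) != 0) ->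
  e = 1%N.
Proof.
move=> uz bz tz injz injt.
pose d t := wedge z (map_mx polyC (pt_at t z)).
have dE s t : (d t).[s] = wedge (pt_at s z) (pt_at t z).
  by rewrite wedge_pt_at pt_at_const.
have bc t : bounded 0 (map_mx polyC (pt_at t z)).
  by move=> i; rewrite mxE size_polyC leq_b1.
have tc t : top 0 (map_mx polyC (pt_at t z)) = pt_at t z.
  by apply/rowP => i; rewrite topE mxE coefC.
have de t : (d t)`_e != 0.
  by rewrite -[e]addn0 top_wedge // tc injt.
have dt t : (d t).[t] = 0 by rewrite dE /wedge; ring.
have e0 : (0 < e)%N.
  case: (posnP e) => // e0; have := de 0.
  have sd : (size (d 0%R) <= 1)%N.
    have := bz; rewrite e0 => b0; rewrite /d /wedge.
    rewrite (leq_trans (size_polyD _ _)) // geq_max size_polyN.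
    by rewrite !(@size_mul_top k _ _ 0 0) // ?b0 ?bc.
  by have := dt 0; rewrite (size1_polyC sd) hornerC e0 coefC => ->; rewrite eqxx.
have [e2|] := ltnP 1 e; last by move: e0; case: (e) => [|[]].
suff [C zC] : exists C, map_mx (@deriv k) z = C *: z.
  case/rV0Pn: tz => j; rewrite topE => /eqP; case.
  have dz : deriv (z 0 j) = 0.
    have /rowP/(_ j) := zC; rewrite !mxE => zj.
    apply/eqP; apply: contraT => z'0.
    have zj0 : z 0 j != 0 by apply: contraNneq z'0 => ->; rewrite deriv0.
    have C0 : C != 0 by apply: contraNneq z'0 => c0; rewrite zj c0 mul0r.
    have := lt_size_deriv zj0; rewrite zj size_mul // ltnNge; case/negP.
    have : (0 < size C)%N by rewrite size_poly_gt0.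
    by case: (size C) => // c _; rewrite addSn leq_addl.
  have := congr1 (fun p : {poly k} => p`_e.-1) dz.
  rewrite coef_deriv coef0 prednK // -mulr_natr => /eqP.
  by rewrite mulf_eq0 -{2}(prednK e0) (negPf (natS_neq0 _)) orbF => /eqP.
case: uz => S SE; exists (\sum_i S i * deriv (z 0 i)); apply/rowP => j.
rewrite [in RHS]mxE -[LHS]mul1r -SE !mulr_suml; apply: eq_bigr => i _.
rewrite -!mulrA; congr (_ * _); rewrite mxE.
suff W : wedge (map_mx (@deriv k) z) z = 0.
  move: i j; apply: ord2_ind; apply: ord2_ind; rewrite 1?mulrC //;
  by move/eqP: W; rewrite subr_eq0 !mxE => /eqP W; rewrite W // mulrC.
apply: (@poly_eq0_generic k 1); first exact: oner_neq0.
move=> t _; have [r rE] : exists r, d t = r * ('X - t%:P).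
  by apply/factor_theorem; rewrite rootE dt.
have r0 : r != 0 by apply: contraNneq (de t) => r0; rewrite rE r0 mul0r coef0.
have sr : (size r != 1)%N.
  have : (e < size (d t))%N.
    by rewrite ltnNge; apply: contraNN (de t) => h; rewrite nth_default.
  rewrite rE size_Mmonic ?monicXsubC // size_XsubC addnS addn1 /=.
  by move=> h; rewrite neq_ltn (leq_trans e2) ?orbT.
have [s /eqP rs] := closed_rootP _ sr.
have st : s = t by apply: injz; rewrite -dE rE hornerM rs mul0r.
have : (deriv (d t)).[t] = 0.
  have rt : r.[t] = 0 by rewrite -st.
  by rewrite rE derivM derivXsubC !hornerE rt; ring.
rewrite wedge_pt_at /d /wedge derivB !derivM !mxE !derivC => h.
by rewrite -[RHS]h /horner_eval !hornerE; ring.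
Qed.

Lemma base_linear : exists2 L, L \in unitmx & forall y, exists b, forall w,
  w != 0 -> G (nu w y 1) (nu (w *m L) b 1).
Proof.
have [z [e [b [uz bz tz Gt Gtop]]]] := fiber_image 0.
have w1 t : mk2 1 t != 0 :> 'rV[k]_2 by apply: mk2_neq0l; apply: oner_neq0.
have w0 : mk2 0 1 != 0 :> 'rV[k]_2 by apply: mk2_neq0r; apply: oner_neq0.
have collinear_nu w v y : collinear w v -> collinear (nu w y 1) (nu v y 1).
  by case=> c c0 ->; exists c; rewrite ?nuZl.
have e1 : e = 1%N.
  apply: (degree_one uz bz tz) => [s t|t].
    move/(wedge_eq0 (unimodular_at s uz) (unimodular_at t uz))/(collinear_nu _ _ b).
    case/(regmap_inj regH GH (Gt s) (Gt t))/(nu_inj1 (w1 s)) => _ /collinear_wedge.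
    by rewrite /wedge !mk2E mul1r mulr1 => /eqP; rewrite subr_eq0 => /eqP.
  apply/eqP => /(wedge_eq0 tz (unimodular_at t uz))/(collinear_nu _ _ b).
  case/(regmap_inj regH GH Gtop (Gt t))/(nu_inj1 w0) => _ /collinear_wedge/eqP.
  by rewrite /wedge !mk2E mul0r mul1r sub0r oppr_eq0 oner_eq0.
rewrite {}e1 in bz tz Gtop.
pose L : 'M[k]_2 := \matrix_(i, j) (z 0 j)`_i.
have L1 t : mk2 1 t *m L = pt_at t z.
  apply/rowP => j; rewrite mulmx2 !mxE /= /horner_eval.
  rewrite (horner_coef_wide _ (bz j)) !big_ord_recl big_ord0 /=; ring.
have L0 : mk2 0 1 *m L = top 1 z.
  by apply/rowP => j; rewrite mulmx2 !mxE /=; ring.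
have cases w : w != 0 -> exists2 v, collinear v w &
    v *m L != 0 /\ G (nu v 0 1) (nu (v *m L) b 1).
  move=> wn0; have [w00|w00] := eqVneq (w 0 0) 0.
    exists (mk2 0 1); last by rewrite L0.
    exists (w 0 1); first by case/row2_neq0/orP: wn0; rewrite ?w00 ?eqxx.
    by apply: row2_eq; rewrite !mxE /= ?w00; ring.
  exists (mk2 1 (w 0 1 / w 0 0)); last by rewrite L1 unimodular_at.
  exists (w 0 0) => //.
  by apply: row2_eq; rewrite !mxE /= ?mulr1 // mulrC divfK.
have uL : L \in unitmx.
  apply: inj_unitmx => w wL; apply/eqP; apply: contraT => /cases[v [c c0 wE]].
  case; rewrite wE -scalemxAl in wL; move/eqP: wL.
  by rewrite scaler_eq0 (negPf c0) /= => ->.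
exists L => // y; have [b' hb'] := fiber_const y.
exists b' => w wn0; have [w' w'0 hw'] := base_const wn0.
have [u u0 Gu] := hb' w wn0; have [by_ Gy] := hw' y.
have [b1 G1] := hw' 0; have [v vw [vL Gv]] := cases w wn0.
have [_ w'L] := nu_inj1 w'0
  (regmap_fun regG G1 Gv (collinear_nu _ _ _ (collinear_sym vw))).
have [be _] := nu_inj1 u0 (regmap_fun regG Gu Gy (collinear_refl _)).
rewrite -be in Gy; apply: (regmap_collinear regG Gy (collinear_refl _)).
apply: collinear_nu.
apply: collinear_trans w'L _; case: vw => c c0 ->; exists c => //.
by rewrite -scalemxAl.
Qed.

(** A line in direction v in the plane over w has the point at infinity
    nu w v 0 = nu v w 0. Its image is the limit of two curves, one over w L and
    one over v L, which leaves v L as the only possible direction. The Jacobian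
    matrix at that point is invertible and preserves the singular plane, so the
    image of the line is transversal to this plane, which means that it has
    degree one. *)
Lemma line_to_line L : L \in unitmx ->
    (forall y, exists b, forall w, w != 0 ->
       G (nu w y 1) (nu (w *m L) b 1)) ->
  forall o v, v != 0 -> exists2 c, c != 0 & exists b, forall t w, w != 0 ->
    G (nu w (o + t *: v) 1) (nu (w *m L) (b + (t * c) *: (v *m L)) 1).
Proof.
move=> uL hL o v v0; have [w vw] := exists_noncollinear v0.
have [_ w0 _] := nu_generic_neq0 vw.
have wv : wedge w v != 0.
  rewrite (_ : wedge w v = - wedge v w) ?oppr_eq0 //.
  by rewrite /wedge; ring.
have wL0 : w *m L != 0 by rewrite mulmx_unit_eq0.
have vL0 : v *m L != 0 by rewrite mulmx_unit_eq0.
have curve u x x' : u != 0 -> exists a, forall t,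
    G (nu u (x + t *: x') 1) (nu (u *m L) (pt_at t a) 1).
  move=> u0; have [z [a [uz Gz]]] := plane_line_image x x' u0.
  exists a => t; have [b hb] := hL (x + t *: x').
  have uL0 : u *m L != 0 by rewrite mulmx_unit_eq0.
  have [<- _] := nu_inj1 uL0
    (regmap_fun regG (hb u u0) (Gz t) (collinear_refl _)).
  exact: hb.
pose cst (x : 'rV[k]_2) : 'rV[{poly k}]_2 := map_mx polyC x.
have ucst x : x != 0 -> unimodular (cst x).
  by move=> x0; apply: unimodularP => t; rewrite pt_at_const.
have bcst x : bounded 0 (cst x).
  by move=> i; rewrite mxE size_polyC leq_b1.
have tcst x : top 0 (cst x) = x.
  by apply/rowP => i; rewrite topE mxE coefC.
have limit u x x' a n : u != 0 -> x' != 0 -> bounded n a ->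
    (top n a != 0) || ((1 : {poly k})`_n != 0) ->
    (forall t, G (nu u (x + t *: x') 1) (nu (u *m L) (pt_at t a) 1)) ->
    G (nu u x' 0) (nu (u *m L) (top n a) (1 : {poly k})`_n).
  move=> u0 x'0 ba ta Ga; rewrite -[X in nu X (top _ _)]tcst.
  have uL0 : u *m L != 0 by rewrite mulmx_unit_eq0.
  apply: (plane_line_limit (o := x)) => //; first exact: ucst.
    by move=> t; rewrite pt_at_const; apply: Ga.
  by rewrite tcst.
have [a Ga] := curve w o v w0; have [a' Ga'] := curve v 0 w v0.
have [n ba ta] := affine_degree a; have [n' ba' ta'] := affine_degree a'.
have lim := limit _ _ _ _ _ w0 v0 ba ta Ga.
have lim' := limit _ _ _ _ _ v0 w0 ba' ta' Ga'; rewrite nu_sym in lim'.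
have [n1 tv] := nu_separate wL0 (wedge_unit uL wv) ta
  (regmap_fun regG lim lim' (collinear_refl _)).
have n_gt0 : (0 < n)%N.
  by rewrite lt0n; apply/eqP => n0; move/eqP: n1; rewrite n0 coef1 oner_eq0.
have nE : n = 1%N.
  have [n_gt1|] := ltnP 1 n; last by move: n_gt0; case: (n) => [|[]].
  set q := nu w v 0; set p := nu w o 1.
  have q0 : q != 0 by rewrite nu_neq0 ?v0.
  have cq : cubic q = 0 by apply: cubic_nu.
  have [d [F [h Grep]]] := regmap_local regG q0 cq.
  have [J hJ] := jacobian F q.
  have uJ : J \in unitmx.
    exact/inj_unitmx/(jacobian_inj chark regG regH GH wv Grep hJ).
  pose P := nu (cst (w *m L)) a 1.
  have [C CE] : exists C, img_along F (ray q p) = C *: map_mx (revp n) P.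
    apply: (line_limit_factor regG q0 (line_rev_cubic w o v) _ _ _ _ Grep).
    - by apply/nu_curve_unimodular/ucst.
    - by move=> t; rewrite line_eq pt_at_nu pt_at_const hornerC.
    - by rewrite -[n]add0n; apply: bounded_nu; rewrite ?size_poly1.
    - by rewrite -[n]add0n top_nu ?size_poly1 // tcst nu_neq0.
  (* the last two coordinates of the reversed curve vanish to order n *)
  have c1 i : (crd P i = ((w *m L) 0%R 0%R)%:P) \/
      (crd P i = ((w *m L) 0%R 1%R)%:P) ->
      crd (p *m J) i = 0.
    move=> Pi; have pE : p *m J = velocity (img_along F (ray q p)).
      by rewrite hJ ?pt_at_ray0 // velocity_ray.
    have sP : (size (crd P i) <= 1)%N.
      by case: Pi => ->; apply: size_polyC_leq1.
    have vE (V : 'rV[{poly k}]_5) : crd (velocity V) i = (crd V i)`_1.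
      by rewrite /crd mxE.
    have rE : crd (map_mx (revp n) P) i = revp n (crd P i) by rewrite /crd mxE.
    have nth0 m : (0 < m)%N -> (crd P i)`_m = 0.
      by move=> m0; rewrite nth_default // (leq_trans sP).
    rewrite pE CE vE crdZ rE coef1M /revp !coef_poly ltnS n_gt0 subn0.
    by rewrite !nth0 ?subn_gt0 // mulr0 mulr0 addr0.
  have c3 : crd (p *m J) 3 = 0 by apply: c1; left; rewrite nuE mul1r mxE.
  have c4 : crd (p *m J) 4 = 0 by apply: c1; right; rewrite nuE mul1r mxE.
  pose B : 'M[k]_(5, 2) := \matrix_(i, j) ((i : nat) == (3 + j)%N)%:R.
  have BE (x : 'rV[k]_5) : (x *m B == 0) = (crd x 3 == 0) && (crd x 4 == 0).
    have xB j : (x *m B) 0 j = crd x (3 + j).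
      rewrite mxE (bigD1 (inord (3 + j))) //= mxE inordK; last first.
        by rewrite -[5%N]/((3 + 2)%N) ltn_add2l.
      rewrite eqxx mulr1 big1 ?addr0 // => i ne; rewrite mxE.
      case: eqP => [e|]; last by rewrite mulr0.
      by case/eqP: ne; rewrite -e inord_val.
    apply/eqP/andP => [/rowP E|[/eqP e3 /eqP e4]].
      by have := (E 0, E 1); rewrite !xB !mxE => -[-> ->].
    by apply/rowP; apply: ord2_ind; rewrite xB mxE.
  have stable : (kermx B *m J <= kermx B)%MS.
    apply/row_subP => i; apply/sub_kermxP/eqP; rewrite BE row_mul.
    set s := row i _; have sB : s *m B == 0.
      by apply/eqP/sub_kermxP/row_sub.
    rewrite BE in sB; case/andP: sB => /eqP s3 /eqP s4.
    have st t : crd (q + t *: s) 3 = 0 /\ crd (q + t *: s) 4 = 0.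
      by rewrite !crdD !crdZ s3 s4 !nuE; split; ring.
    have cs : cubic (ray q s) = 0.
      apply: ray_cubic => t; have [e3 e4] := st t.
      by rewrite /cubic e3 e4; ring.
    have [g g0 Gg] := represents_curve Grep q0 (pt_at_ray0 q s) cs.
    have gn0 : g != 0 by apply: contraNneq g0 => ->; rewrite horner0.
    have R0 i' : (i' = 3 \/ i' = 4)%N -> crd (img_along F (ray q s)) i' = 0.
      move=> hi; apply: (poly_eq0_generic gn0) => t /Gg; rewrite pt_at_ray => Gt.
      have [e3 e4] := st t.
      have [z3 z4] := plane_image chark regG regH GH Gt e3 e4.
      by rewrite -crd_pt_at; case: hi => ->.
    rewrite -(velocity_ray q s) -hJ ?pt_at_ray0 // /crd !mxE.
    have := (R0 3 (or_introl erefl), R0 4 (or_intror erefl)).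
    by rewrite /crd !mxE => -[-> ->]; rewrite !coef0 eqxx.
  have eqK : (kermx B <= kermx B *m J)%MS.
    rewrite -(geq_leqif (mxrank_leqif_sup stable)).
    by rewrite mxrankMfree // row_free_unit.
  have : (p <= kermx B)%MS.
    have fJ : row_free J by rewrite row_free_unit.
    rewrite -(submxMfree _ _ fJ); apply: submx_trans eqK.
    by apply/sub_kermxP/eqP; rewrite BE c3 c4 !eqxx.
  move/sub_kermxP/eqP; rewrite BE !nuE !mul1r => /andP[/eqP w00 /eqP w01].
  by case/eqP: w0; apply: row2_eq; rewrite mxE.
rewrite nE in ba tv.
have aE t : pt_at t a = pt_at 0 a + t *: top 1 a.
  apply/rowP => j; rewrite !mxE /horner_eval horner_coef0.
  by rewrite (horner_coef_wide _ (ba j)) !big_ord_recl big_ord0 /=; ring.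
case/collinear_sym: tv => c c0 tc; exists c => //; exists (pt_at 0 a) => t u u0.
have [b hb] := hL (o + t *: v).
have [e _] := nu_inj1 wL0 (regmap_fun regG (hb w w0) (Ga t) (collinear_refl _)).
by have := hb u u0; rewrite e aE tc scalerA.
Qed.

(** The image of a line in direction v is a line in direction v L, so the
    difference quotient in direction v is c (v L) with a scalar c; following two
    sides of a triangle instead of the third one shows that c does not depend on
    v. It is absorbed into L, whose action on P^1 it does not change. *)
Theorem automorphism_linear : exists L b, L \in unitmx /\ forall w y, w != 0 ->
  G (nu w y 1) (nu (w *m L) (y *m L + b) 1).
Proof.
have [L uL hL] := base_linear.
pose T y b := forall w, w != 0 -> G (nu w y 1) (nu (w *m L) b 1).
have e0 : mk2 1 0 != 0 :> 'rV[k]_2 by apply: mk2_neq0l; apply: oner_neq0.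
have e1 : mk2 0 1 != 0 :> 'rV[k]_2 by apply: mk2_neq0r; apply: oner_neq0.
have Tfun y b b' : T y b -> T y b' -> b = b'.
  move=> /(_ _ e0) Gb /(_ _ e0) Gb'.
  have eL : mk2 1 0 *m L != 0 by rewrite mulmx_unit_eq0.
  by have [] := nu_inj1 eL (regmap_fun regG Gb Gb' (collinear_refl _)).
have Tline o v b : v != 0 -> T o b ->
    exists2 c, c != 0 & T (o + v) (b + c *: (v *m L)).
  move=> v0 Tb; have [c c0 [b' hb]] := line_to_line uL hL o v0.
  exists c => //; have -> : b = b'.
    apply: Tfun Tb _ => w w0; have := hb 0 w w0.
    by rewrite mul0r !scale0r !addr0.
  by move=> w w0; have := hb 1 w w0; rewrite mul1r scale1r.
have [b0 Tb0] : exists b, T 0 b by have [b hb] := hL 0; exists b.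
have T0 v : v != 0 -> exists2 c, c != 0 & T v (b0 + c *: (v *m L)).
  by move=> v0; have [c c0] := Tline _ _ _ v0 Tb0; rewrite add0r; exists c.
have Tc u v c c' : wedge u v != 0 -> T u (b0 + c *: (u *m L)) ->
    T v (b0 + c' *: (v *m L)) -> c' = c.
  move=> uv Tu Tv; have [u0 v0 _] := nu_generic_neq0 uv.
  have vu : v - u != 0.
    apply: contraNneq uv => /subr0_eq ->; rewrite /wedge; apply/eqP; ring.
  have [d d0] := Tline _ _ _ vu Tu; rewrite addrC subrK => Tv'.
  have /eqP := Tfun _ _ _ Tv Tv'; rewrite -addrA.
  move/eqP/addrI; rewrite !scalemxAl -mulmxDl => /(can_inj (mulmxK uL)) e.
  have : (c' - d) * wedge u v = 0 /\ (c - d) * wedge u v = 0.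
    split.
      have -> : (c' - d) * wedge u v = wedge u (c' *: v) - d * wedge u v.
        by rewrite /wedge !mxE; ring.
      by rewrite e /wedge !mxE; ring.
    have -> : (c - d) * wedge u v = wedge (c *: u) v - d * wedge u v.
      by rewrite /wedge !mxE; ring.
    have -> : c *: u = c' *: v - d *: (v - u) by rewrite e addrK.
    by rewrite /wedge !mxE; ring.
  case=> /eqP; rewrite mulf_eq0 (negPf uv) orbF => /eqP/subr0_eq ->.
  by move/eqP; rewrite mulf_eq0 (negPf uv) orbF => /eqP/subr0_eq ->.
have [c c0 Te0] := T0 _ e0; have [c' c'0 Te1] := T0 _ e1.
have w01 : wedge (mk2 1 0) (mk2 0 1) != 0 :> k.
  by rewrite /wedge !mk2E mul0r subr0 mulr1 oner_neq0.
have cE := Tc _ _ _ _ w01 Te0 Te1; rewrite {}cE in Te1.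
have Tall y : T y (b0 + c *: (y *m L)).
  have [->|y0] := eqVneq y 0; first by rewrite mul0mx scaler0 addr0.
  have [d d0 Ty] := T0 y y0.
  suff <- : d = c by [].
  have [e0y|/Tc] := eqVneq (wedge (mk2 1 0) y) 0; last by apply.
  apply: (Tc (mk2 0 1) y) => //; apply: contraNneq y0 => e1y.
  apply/eqP/row2_eq; rewrite mxE.
    move: e1y; rewrite /wedge !mk2E mul0r mul1r sub0r => /eqP.
    by rewrite oppr_eq0 => /eqP.
  by move: e0y; rewrite /wedge !mk2E mul0r mul1r subr0.
exists (c *: L), b0; split; first by rewrite unitmxZ // unitfE.
move=> w y w0; rewrite -!scalemxAr addrC nuZl.
apply: (regmap_collinear regG (Tall y w w0) (collinear_refl _)).
by exists c.
Qed.

End Structure.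

(** * Points and their homogeneous coordinates *)

Section Points.

Variables (k : closedFieldType) (n : nat).
Implicit Types (x : proj k n) (v : 'rV[k]_n.+1).

Definition vec x : 'rV[k]_n.+1 := vpick (line x).

Lemma vec_neq0 x : vec x != 0.
Proof.
rewrite /vec vpick0; apply: contraTneq (valP x) => lx.
by rewrite -/(line x) lx dimv0.
Qed.

Lemma line_vec x : line x = <[vec x]>%VS.
Proof.
apply/esym/eqP; rewrite eqEdim -memvE memv_pick /= dim_vline vec_neq0.
by rewrite (eqP (valP x)).
Qed.

Lemma proj_of v : v != 0 -> {x : proj k n | line x = <[v]>%VS}.
Proof.
move=> v0; have d1 : \dim <[v]> == 1%N by rewrite dim_vline v0.
by exists (exist _ <[v]>%VS d1).
Qed.

Lemma vline_eq v v' : v != 0 -> (<[v]>%VS = <[v']>%VS) <-> collinear v v'.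
Proof.
move=> v0; split=> [e|[c c0 ->]].
  have /vlineP[c cE] : v' \in <[v]>%VS by rewrite e memv_line.
  exists c => //; apply: contraNneq v0 => c0.
  have := memv_line v; rewrite e cE c0 scale0r => /vlineP[d ->].
  by rewrite scaler0.
apply/eqP; rewrite eqEdim !dim_vline scaler_eq0 (negPf c0) /= leqnn andbT.
by rewrite -memvE; apply/vlineP; exists c^-1; rewrite scalerA mulVf ?scale1r.
Qed.

Lemma line_neq0 x v : line x = <[v]>%VS -> v != 0.
Proof.
move=> e; have := valP x; rewrite -/(line x) e dim_vline.
by case: (v == 0).
Qed.

Lemma line_inj x x' : line x = line x' -> x = x'.
Proof.
move=> e; exact: (@val_inj _ _ {L : {vspace 'rV[k]_n.+1} | \dim L == 1%N}).
Qed.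

Lemma vec_collinear x v : line x = <[v]>%VS -> collinear v (vec x).
Proof.
by move=> e; apply/(vline_eq _ (line_neq0 e)); rewrite -e line_vec.
Qed.

Lemma vanishesE d (p : {mpoly k[n.+1]}) x v : p \is d.-homog ->
  line x = <[v]>%VS -> vanishes p x = (p.@[v 0] == 0).
Proof.
move=> hp /vec_collinear[c c0 e]; rewrite /vanishes.
have -> : p.@[hcoord x] = p.@[vec x 0] by apply: meval_eq.
by rewrite e (meval_homog _ _ hp) mulf_eq0 expf_eq0 (negPf c0) andbF.
Qed.

Lemma meval_hcoord (p : {mpoly k[n.+1]}) x : p.@[hcoord x] = p.@[vec x 0].
Proof. exact: meval_eq. Qed.

End Points.

Section Threefold.

Variable k : closedFieldType.
Implicit Types (v z : 'rV[k]_5).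

Lemma meval_cubic v : (cubic_form k).@[v 0] = cubic v.
Proof.
by rewrite /cubic_form /cubic /crd !(mevalD, mevalM, rmorphXn, mevalXU).
Qed.

Lemma homogX n (i : 'I_n) : ('X_i : {mpoly k[n]}) \is 1.-homog.
Proof. by rewrite dhomogX /= mdeg1. Qed.

Lemma homogC n c : (c%:MP : {mpoly k[n]}) \is 0.-homog.
Proof. by rewrite -[c%:MP]mulr1 mul_mpolyC dhomogZ // dhomog1. Qed.

Lemma cubic_homog : cubic_form k \is 3.-homog.
Proof.
rewrite /cubic_form; apply: rpredD; first apply: rpredD.
- exact: (dhomogM (homogX _) (dhomogMn 2 (homogX _))).
- exact: (dhomogM (dhomogM (homogX _) (homogX _)) (homogX _)).
- exact: (dhomogM (homogX _) (dhomogMn 2 (homogX _))).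
Qed.

Lemma cubic_pt (x : proj k 4) v : line x = <[v]>%VS ->
  (x \in cubic_threefold k) = (cubic v == 0).
Proof. by move=> e; rewrite inE (vanishesE cubic_homog e) meval_cubic. Qed.

Lemma point_of v : v != 0 -> cubic v = 0 ->
  {a : points (cubic_threefold k) | line (pt a) = <[v]>%VS}.
Proof.
move=> v0 cv; have [x xE] := proj_of v0.
have xX : x \in cubic_threefold k by rewrite (cubic_pt xE) cv.
by exists (exist _ x xX).
Qed.

Lemma points_inj (S : {pred proj k 4}) (a b : points S) :
  line (pt a) = line (pt b) -> a = b.
Proof. by move=> e; apply/val_inj/line_inj. Qed.

Definition graph (f : points (cubic_threefold k) -> points (cubic_threefold k))
    v z :=
  exists a, line (pt a) = <[v]>%VS /\ line (pt (f a)) = <[z]>%VS.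

Lemma point_cubic (a : points (cubic_threefold k)) v :
  line (pt a) = <[v]>%VS -> cubic v = 0.
Proof. by move=> e; have := valP a; rewrite (cubic_pt e) => /eqP. Qed.

Lemma graph_regmap f : regular f -> regmap (graph f).
Proof.
move=> rf; split.
- move=> v z [a [av az]]; split.
  + exact: line_neq0 av.
  + exact: point_cubic av.
  + exact: line_neq0 az.
  + exact: point_cubic az.
- move=> v v0 cv; have [a av] := point_of v0 cv.
  by exists (vec (pt (f a))), a; rewrite -line_vec.
- move=> v z v' z' [a [av az]] [a' [av' az']] p.
  apply/(vline_eq _ (line_neq0 az)); rewrite -az -az'; congr (line (pt (f _))).
  by apply: points_inj; rewrite av av'; apply/vline_eq => //; apply: line_neq0 av.
- move=> v z v' z' [a [av az]] pv pz; exists a; split.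
    by rewrite av; apply/vline_eq => //; apply: line_neq0 av.
  by rewrite az; apply/vline_eq => //; apply: line_neq0 az.
- move=> v v0 cv; have [a av] := point_of v0 cv.
  have [i vi] := rV0Pn _ v0.
  have [d [e [F [h [hF hh ha hE]]]]] := rf a.
  exists d.+1, (fun j => F j * 'X_i), (h * 'X_i); split=> //.
  + by move=> j; have := dhomogM (hF j) (homogX i); rewrite addn1.
  + by rewrite mevalM mevalXU mulf_neq0 // -(vanishesE hh av).
  move=> z z0 cz; rewrite mevalM mevalXU mulf_eq0 negb_or => /andP[hz zi].
  have [b bz] := point_of z0 cz; exists b; split=> //.
  have fb := hE b; rewrite (vanishesE hh bz) in fb; have {}fb := fb hz.
  rewrite fb; apply/(vline_eq _ (line_neq0 fb)).
  have [c c0 vE] := vec_collinear bz.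
  exists (z 0 i / c ^+ d); first by rewrite mulf_neq0 ?invr_eq0 ?expf_neq0.
  apply/rowP => j; rewrite !mxE meval_hcoord vE (meval_homog _ _ (hF j)).
  by rewrite mevalM mevalXU; field; rewrite expf_neq0.
Qed.

End Threefold.

(** * Finite groups of automorphisms *)

Lemma total_actM (gT : finGroupType) (T : Type) (to : {action gT &-> T}) x g h :
  to x (g * h)%g = to (to x g) h.
Proof. by case: to => f fP /=; have [_ fM] := fP; apply: fM; rewrite inE. Qed.

Lemma total_act1 (gT : finGroupType) (T : Type) (to : {action gT &-> T}) x :
  to x 1%g = x.
Proof.
have inj1 : injective (to^~ 1%g).
  by case: to => f fP /=; have [injf _] := fP; apply: injf.
by apply: inj1; rewrite -total_actM mulg1.
Qed.

Section Group.

Variables (k : closedFieldType) (gT : finGroupType).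
Hypothesis chark : [pchar k] =i pred0.
Variable to : {action gT &-> points (cubic_threefold k)}.
Hypothesis reg_to : forall g : gT, regular (fun a => to a g).

Lemma affine_system : exists (L : gT -> 'M[k]_2) (b : gT -> 'rV[k]_2),
  (forall g, L g \in unitmx) /\
  forall g w y, w != 0 -> graph (fun a => to a g) (nu w y 1)
    (nu (w *m L g) (y *m L g + b g) 1).
Proof.
have S g : exists Lb : 'M[k]_2 * 'rV[k]_2, Lb.1 \in unitmx /\
    forall w y, w != 0 -> graph (fun a => to a g) (nu w y 1)
      (nu (w *m Lb.1) (y *m Lb.1 + Lb.2) 1).
  have [] := automorphism_linear chark (graph_regmap (reg_to g))
    (graph_regmap (reg_to g^-1%g)).
    move=> x z; split=> -[a [ax az]].
      by exists (to a g); split=> //=; rewrite -total_actM mulgV total_act1.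
    by exists (to a g^-1%g); split=> //=; rewrite -total_actM mulVg total_act1.
  by move=> L [b [uL hL]]; exists (L, b).
have [f hf] := fin_all_exists S.
exists (fun g => (f g).1), (fun g => (f g).2); split=> g; first by case: (hf g).
by case: (hf g) => _; apply.
Qed.

Lemma graph_collinear (f : points (cubic_threefold k) -> points (cubic_threefold k))
    v z z' : graph f v z -> graph f v z' -> collinear z z'.
Proof.
case=> a [av az] [a' [a'v az']]; apply/(vline_eq _ (line_neq0 az)).
by rewrite -az -az'; congr (line (pt (f _))); apply: points_inj; rewrite av.
Qed.

(** Finite groups of affine transformations have a fixed point, the centroid
    of an orbit, so the action on X off the singular plane becomes the
    diagonal action of one representation L on P(V) x V. *)
Theorem diagonal_action : exists (L : gT -> 'M[k]_2) (b0 : 'rV[k]_2),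
  [/\ forall g, L g \in unitmx, L 1%g = 1%:M,
      forall g h, L (g * h)%g = L g *m L h &
      forall g a w v, w != 0 -> line (pt a) = <[nu w (b0 + v) 1]>%VS ->
        line (pt (to a g)) = <[nu (w *m L g) (b0 + v *m L g) 1]>%VS].
Proof.
have [L [b [uL hL]]] := affine_system.
have e0 : mk2 1 0 != 0 :> 'rV[k]_2 by apply: mk2_neq0l; apply: oner_neq0.
have affine_eq (A B : 'M[k]_2) (c d : 'rV[k]_2) :
    (forall y, y *m A + c = y *m B + d) -> A = B /\ c = d.
  move=> e; have cd : c = d by have := e 0; rewrite !mul0mx !add0r.
  split=> //; apply/row_matrixP => i; rewrite !rowE.
  by have := e (delta_mx 0 i); rewrite cd => /addIr.
have L1 : L 1%g = 1%:M /\ b 1%g = 0.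
  apply: affine_eq => y; have G1 := hL 1%g _ y e0.
  have G1' : graph (fun a => to a 1%g) (nu (mk2 1 0) y 1) (nu (mk2 1 0) y 1).
    case: G1 => a [av _]; exists a; split=> //.
    by rewrite /= total_act1.
  have eL : mk2 1 0 *m L 1%g != 0 by rewrite mulmx_unit_eq0.
  have [-> _] := nu_inj1 eL (graph_collinear G1 G1').
  by rewrite mulmx1 addr0.
have LM g h : L (g * h)%g = L g *m L h /\ b (g * h)%g = b g *m L h + b h.
  apply: affine_eq => y; have Ggh := hL (g * h)%g _ y e0.
  have eL x : mk2 1 0 *m L x != 0 by rewrite mulmx_unit_eq0.
  have [a [ax az]] := hL g _ y e0.
  have [a' [ax' az']] := hL h _ (y *m L g + b g) (eL g).
  have aa' : a' = to a g by apply: points_inj; rewrite ax' az.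
  have Ggh' : graph (fun a => to a (g * h)%g) (nu (mk2 1 0) y 1)
     (nu (mk2 1 0 *m L g *m L h) ((y *m L g + b g) *m L h + b h) 1).
    by exists a; rewrite /= total_actM -aa'.
  have [-> _] := nu_inj1 (eL _) (graph_collinear Ggh Ggh').
  by rewrite mulmxDl mulmxA addrA.
have n0 := card_neq0 chark gT.
pose b0 := #|gT|%:R^-1 *: \sum_g b g.
have fix_b0 h : b0 *m L h + b h = b0.
  rewrite /b0 -scalemxAl mulmx_suml.
  have -> : b h = #|gT|%:R^-1 *: \sum_(g : gT) b h.
    by rewrite sumr_const -scaler_nat scalerA mulVf ?scale1r.
  rewrite -scalerDr -big_split; congr (_ *: _).
  rewrite [RHS](reindex_inj (mulIg h)) /=.
  by apply: eq_bigr => g _; case: (LM g h).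
exists L, b0; split=> //; [by case: L1|by move=> g h; case: (LM g h)|].
move=> g a w v w0 av; have := hL g w (b0 + v) w0.
rewrite mulmxDl addrAC fix_b0 => -[a' [a'v <-]].
by congr (line (pt (to _ g))); apply: points_inj; rewrite av.
Qed.

End Group.

(** * A birational model of P(V) x V *)

Section Model.

Variables (R : comNzRingType) (I : finType) (c1 c2 : I -> R) (b0 : 'rV[R]_2).
Implicit Types (w v : 'rV[R]_2).

Definition lin i w := c1 i * w 0 0 + c2 i * w 0 1.

Definition norm w := \prod_i lin i w.

(** The derivative of norm at w in the direction v. *)
Definition dnorm w v := \sum_i lin i v * \prod_(j | j != i) lin j w.

Lemma dnorm_self w : dnorm w w = #|I|%:R * norm w.
Proof.
rewrite /dnorm (eq_bigr (fun=> norm w)) => [|i _].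
  by rewrite sumr_const mulr_natl.
by rewrite /norm [RHS](bigD1 i).
Qed.

Lemma dnormE w v :
  dnorm w v = dnorm w (mk2 1 0) * v 0 0 + dnorm w (mk2 0 1) * v 0 1.
Proof.
rewrite /dnorm !mulr_suml -big_split; apply: eq_bigr => i _ /=.
by rewrite /lin !mk2E; ring.
Qed.

(** A vector on which the derivative of norm at w vanishes. *)
Definition conormal w : 'rV[R]_2 :=
  mk2 (- dnorm w (mk2 0 1)) (dnorm w (mk2 1 0)).

Lemma wedge_conormal w : wedge w (conormal w) = #|I|%:R * norm w.
Proof. by rewrite -dnorm_self dnormE /wedge /conormal !mk2E; ring. Qed.

Lemma dnorm_conormal w : dnorm w (conormal w) = 0.
Proof. by rewrite dnormE /conormal !mk2E; ring. Qed.

Definition base (x : 'rV[R]_5) := mk2 (crd x 3) (crd x 4).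

(** x_5 ^ 2 times the difference between the affine coordinates y of x and the
    origin b0. *)
Definition fib (x : 'rV[R]_5) :=
  mk2 (- (crd x 1 * crd x 4 + crd x 0 * crd x 3) - b0 0 0 * crd x 4 ^+ 2)
      (crd x 0 * crd x 4 - b0 0 1 * crd x 4 ^+ 2).

(** The map ([w], v) |-> [w : w /\ v : (w /\ v)^2 dnorm w v / norm w], with
    denominators cleared. *)
Definition fwd (x : 'rV[R]_5) : 'rV[R]_(2 + 2) :=
  let w := base x in let v := fib x in
  row_mx (mk2 (crd x 4 ^+ 6 * norm w * w 0 0) (crd x 4 ^+ 6 * norm w * w 0 1))
         (mk2 (crd x 4 ^+ 4 * norm w * wedge w v)
              (wedge w v ^+ 2 * dnorm w v)).

(** The inverse map: with z the conormal of w, n = #|I| and F = norm w, the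
    vector v = (b / (n a^2)) w + (a / (n F)) z solves w /\ v = a and
    dnorm w v = b F / a^2. *)
Definition bwd (p : 'rV[R]_(2 + 2)) : 'rV[R]_5 :=
  let w := lsubmx p in let a := rsubmx p 0 0 in let b := rsubmx p 0 1 in
  let s := #|I|%:R * a ^+ 2 * norm w in
  nu w (s *: b0 + (b * norm w) *: w + a ^+ 3 *: conormal w) s.

Lemma fib_nu w v : fib (nu w (b0 + v) 1) = w 0 1 ^+ 2 *: v.
Proof.
by apply: row2_eq; rewrite /fib !mk2E !nuE !mxE; ring.
Qed.

Lemma base_nu w v : base (nu w v 1) = w.
Proof. by apply: row2_eq; rewrite /base mk2E nuE mul1r. Qed.

Lemma fwd_nu w v : fwd (nu w (b0 + v) 1) = w 0 1 ^+ 6 *: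
  row_mx (norm w *: w) (mk2 (norm w * wedge w v) (wedge w v ^+ 2 * dnorm w v)).
Proof.
rewrite /fwd fib_nu base_nu nuE mul1r scale_row_mx; congr row_mx.
  by apply: row2_eq; rewrite ?mk2E !mxE /=; ring.
rewrite !(dnormE w (_ *: v)) (dnormE w v).
by apply: row2_eq; rewrite ?mk2E !mxE /= /wedge ?mxE; ring.
Qed.

Definition fwd_locus (x : 'rV[R]_5) : R :=
  crd x 4 * norm (base x) * wedge (base x) (fib x).

Definition bwd_locus (p : 'rV[R]_(2 + 2)) : R :=
  lsubmx p 0 1 * norm (lsubmx p) * rsubmx p 0 0.

End Model.

Section Morphism.

Variables (R S : comNzRingType) (f : {rmorphism R -> S}) (I : finType).
Variables (c1 c2 : I -> R) (d1 d2 : I -> S) (b0 : 'rV[R]_2).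
Hypotheses (d1E : forall i, f (c1 i) = d1 i) (d2E : forall i, f (c2 i) = d2 i).

Lemma rmorph_lin i w : f (lin c1 c2 i w) = lin d1 d2 i (map_mx f w).
Proof. by rewrite /lin rmorphD !rmorphM !mxE d1E d2E. Qed.

Lemma rmorph_norm w : f (norm c1 c2 w) = norm d1 d2 (map_mx f w).
Proof. by rewrite /norm rmorph_prod; apply: eq_bigr => i _; apply: rmorph_lin. Qed.

Lemma rmorph_dnorm w v :
  f (dnorm c1 c2 w v) = dnorm d1 d2 (map_mx f w) (map_mx f v).
Proof.
rewrite /dnorm rmorph_sum; apply: eq_bigr => i _.
rewrite rmorphM rmorph_prod rmorph_lin; congr (_ * _).
by apply: eq_bigr => j _; apply: rmorph_lin.
Qed.

Lemma map_mk2 a b : map_mx f (mk2 a b) = mk2 (f a) (f b).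
Proof. by apply: row2_eq; rewrite mxE !mk2E. Qed.

Lemma rmorph_wedge w v : f (wedge w v) = wedge (map_mx f w) (map_mx f v).
Proof. by rewrite /wedge rmorphB !rmorphM !mxE. Qed.

Lemma crd_map x i : crd (map_mx f x) i = f (crd x i).
Proof. by rewrite /crd mxE. Qed.

Lemma map_base x : map_mx f (base x) = base (map_mx f x).
Proof. by rewrite /base map_mk2 !crd_map. Qed.

Lemma map_fib x : map_mx f (fib b0 x) = fib (map_mx f b0) (map_mx f x).
Proof.
rewrite /fib map_mk2 !crd_map; congr mk2;
by rewrite !(rmorphB, rmorphN, rmorphD, rmorphM, rmorphXn) ?mxE.
Qed.

Lemma map_fwd x :
  map_mx f (fwd c1 c2 b0 x) = fwd d1 d2 (map_mx f b0) (map_mx f x).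
Proof.
rewrite /fwd map_row_mx !map_mk2 !(rmorphXn, rmorphM) /=.
rewrite rmorph_norm rmorph_dnorm rmorph_wedge map_base map_fib !crd_map.
by rewrite /base !mk2E !crd_map.
Qed.

Lemma map_bwd p :
  map_mx f (bwd c1 c2 b0 p) = bwd d1 d2 (map_mx f b0) (map_mx f p).
Proof.
rewrite /bwd map_nu !map_mxD !map_mxZ /conormal map_mk2.
rewrite !(rmorphM, rmorphXn, rmorphN).
rewrite rmorph_norm !rmorph_dnorm !map_mk2 rmorph0 rmorph1 rmorph_nat.
by rewrite -!map_lsubmx -!map_rsubmx !mxE.
Qed.

Lemma rmorph_fwd_locus x :
  f (fwd_locus c1 c2 b0 x) = fwd_locus d1 d2 (map_mx f b0) (map_mx f x).
Proof.
by rewrite /fwd_locus !rmorphM rmorph_norm rmorph_wedge map_base map_fib crd_map.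
Qed.

Lemma rmorph_bwd_locus p :
  f (bwd_locus c1 c2 p) = bwd_locus d1 d2 (map_mx f p).
Proof.
rewrite /bwd_locus !rmorphM rmorph_norm -!map_lsubmx -!map_rsubmx.
by rewrite !mxE.
Qed.

End Morphism.

Section Inverse.

Variables (k : closedFieldType) (I : finType) (c1 c2 : I -> k) (b0 : 'rV[k]_2).
Hypothesis cardI : (#|I|%:R : k) != 0.
Implicit Types (w v : 'rV[k]_2).

Local Notation nm := (norm c1 c2).
Local Notation dn := (dnorm c1 c2).
Local Notation fw := (fwd c1 c2 b0).
Local Notation bw := (bwd c1 c2 b0).

(** The two linear forms wedge w and dnorm w are independent: the first kills
    w, and Euler's identity says that the second does not. *)
Lemma wedge_dnorm_inj w v v' : nm w != 0 -> w != 0 ->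
  wedge w v = wedge w v' -> dn w v = dn w v' -> v = v'.
Proof.
move=> n0 w0 ew ed; apply/subr0_eq/eqP; apply: contraT => vv'.
have [c c0 vE] : collinear w (v - v').
  apply: wedge_eq0 => //.
  have -> : wedge w (v - v') = wedge w v - wedge w v'.
    by rewrite /wedge !mxE; ring.
  by rewrite ew subrr.
have : c * (#|I|%:R * nm w) = 0.
  rewrite -dnorm_self.
  have -> : c * dn w w = dn w (v - v').
    by rewrite vE (dnormE _ _ w w) (dnormE _ _ w (c *: w)) !mxE; ring.
  have -> : dn w (v - v') = dn w v - dn w v'.
    by rewrite !(dnormE _ _ w (_ - _)) (dnormE _ _ w v) (dnormE _ _ w v') !mxE; ring.
  by rewrite ed subrr.
by move/eqP; rewrite !mulf_eq0 (negPf c0) (negPf cardI) (negPf n0).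
Qed.

Lemma fwd_locus_nu w v : (fwd_locus c1 c2 b0 (nu w (b0 + v) 1) != 0) =
  (w 0 1 != 0) && (nm w != 0) && (wedge w v != 0).
Proof.
rewrite /fwd_locus fib_nu base_nu nuE mul1r.
have -> : wedge w (w 0 1 ^+ 2 *: v) = w 0 1 ^+ 2 * wedge w v.
  by rewrite /wedge !mxE; ring.
rewrite !mulf_eq0 !negb_or ?expf_eq0 /=.
by case: (w 0 1 == 0); rewrite //= andbT.
Qed.

Lemma fwd_collinear w v : w 0 1 != 0 -> nm w != 0 ->
  collinear (fw (nu w (b0 + v) 1))
    (row_mx w (mk2 (wedge w v) (wedge w v ^+ 2 * dn w v / nm w))).
Proof.
move=> w1 n0; rewrite fwd_nu; apply: collinear_sym.
exists (w 0 1 ^+ 6 * nm w); first by rewrite mulf_neq0 ?expf_neq0.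
rewrite -scalerA; congr (_ *: _); rewrite scale_row_mx; congr row_mx.
by apply: row2_eq; rewrite !mxE //= [RHS]mulrC divfK.
Qed.

Lemma bwd_collinear w a b : w 0 1 != 0 -> nm w != 0 -> a != 0 ->
  exists v, [/\ wedge w v = a, dn w v = b * nm w / a ^+ 2 &
    collinear (bw (row_mx w (mk2 a b))) (nu w (b0 + v) 1)].
Proof.
move=> w1 n0 a0.
pose v := (b / (#|I|%:R * a ^+ 2)) *: w + (a / (#|I|%:R * nm w)) *: conormal c1 c2 w.
exists v; split.
- have -> : wedge w v = a / (#|I|%:R * nm w) * wedge w (conormal c1 c2 w).
    by rewrite /wedge !mxE; ring.
  by rewrite wedge_conormal divfK ?mulf_neq0.
- have -> : dn w v = b / (#|I|%:R * a ^+ 2) * dn w w +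
      a / (#|I|%:R * nm w) * dn w (conormal c1 c2 w).
    rewrite !(dnormE _ _ w v) (dnormE _ _ w w) (dnormE _ _ w (conormal _ _ _)).
    by rewrite [v 0 0]mxE [v 0 1]mxE !mxE; ring.
  by rewrite dnorm_self dnorm_conormal; field; rewrite a0 n0 cardI.
have s0 : #|I|%:R * a ^+ 2 * nm w != 0 by rewrite !mulf_neq0 ?expf_neq0.
apply: collinear_sym; exists (#|I|%:R * a ^+ 2 * nm w) => //.
rewrite -nuZr mulr1 /bwd row_mxKl row_mxKr !mk2E; congr nu.
rewrite !scalerDr addrA; congr (_ + _ + _); rewrite scalerA; congr (_ *: _).
  by field; rewrite a0 cardI.
by field; rewrite n0 cardI.
Qed.

Lemma bwd_locus_row w u :
  (bwd_locus c1 c2 (row_mx w u) != 0) = (w 0 1 != 0) && (nm w != 0) && (u 0 0 != 0).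
Proof. by rewrite /bwd_locus row_mxKl row_mxKr !mulf_eq0 !negb_or. Qed.

End Inverse.

(** * Homogeneity of the forms *)

Section Homogeneity.

Variables (k : closedFieldType) (n : nat) (I : finType) (c1 c2 : I -> k).
Implicit Types (p q : {mpoly k[n]}) (w v : 'rV[{mpoly k[n]}]_2).

Local Notation C1 := (fun i => (c1 i)%:MP_[n]).
Local Notation C2 := (fun i => (c2 i)%:MP_[n]).

Lemma homogM p q d e f : p \is d.-homog -> q \is e.-homog -> f = (d + e)%N ->
  p * q \is f.-homog.
Proof. by move=> hp hq ->; apply: dhomogM. Qed.

Lemma homog_prod1 (J : finType) (P : pred J) (f : J -> {mpoly k[n]}) :
  (forall j, P j -> f j \is 1.-homog) -> \prod_(j | P j) f j \is #|P|.-homog.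
Proof.
move=> hf; rewrite -sum1_card.
apply: (big_rec2 (fun (p : {mpoly k[n]}) (d : nat) => p \is d.-homog)).
  exact: dhomog1.
by move=> j d p Pj hp; apply: dhomogM (hf j Pj) hp.
Qed.

Definition homog2 d w := forall i, w 0 i \is d.-homog.

Lemma homog_mk2 d p q : p \is d.-homog -> q \is d.-homog -> homog2 d (mk2 p q).
Proof. by move=> hp hq; apply: ord2_ind; rewrite mk2E. Qed.

Lemma homog_lin i d w : homog2 d w -> lin C1 C2 i w \is d.-homog.
Proof.
by move=> hw; rewrite /lin; apply: rpredD; apply: (homogM (homogC _ _) (hw _)).
Qed.

Lemma homog_norm w : homog2 1 w -> norm C1 C2 w \is #|I|.-homog.
Proof. by move=> hw; apply: homog_prod1 => i _; apply: homog_lin. Qed.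

Lemma homog_dnorm d w v : homog2 1 w -> homog2 d v ->
  dnorm C1 C2 w v \is (d + #|I|.-1).-homog.
Proof.
move=> hw hv; apply: rpred_sum => i _; apply: (homogM (homog_lin i hv)).
  by apply: homog_prod1 => j _; apply: homog_lin.
by rewrite -(cardC1 i).
Qed.

Lemma homog_wedge d e w v : homog2 d w -> homog2 e v ->
  wedge w v \is (d + e).-homog.
Proof.
by move=> hw hv; apply: rpredB; apply: (homogM (hw _) (hv _)).
Qed.

End Homogeneity.

Section MapsOfForms.

Variables (k : closedFieldType) (n m : nat).

Lemma forms_collinear (F : 'I_m.+1 -> {mpoly k[n.+1]}) d (v v' : 'rV[k]_n.+1) :
    (forall j, F j \is d.-homog) -> collinear v v' ->
  collinear (\row_j (F j).@[v 0]) (\row_j (F j).@[v' 0]).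
Proof.
move=> hF [c c0 ->]; exists (c ^+ d); first exact: expf_neq0.
by apply/rowP=> j; rewrite !mxE (meval_homog _ _ (hF j)).
Qed.

Lemma map_of_forms (S : {pred proj k n}) (T : {pred proj k m}) d
    (F : 'I_m.+1 -> {mpoly k[n.+1]}) : (forall j, F j \is d.-homog) ->
    (forall x : points S, {y : points T |
       line (pt y) = <[\row_j (F j).@[vec (pt x) 0%R]]>%VS}) ->
  {f : points S -> points T | regular f /\ forall x v,
     line (pt x) = <[v]>%VS -> line (pt (f x)) = <[\row_j (F j).@[v 0%R]]>%VS}.
Proof.
move=> hF hT; exists (fun x => sval (hT x)); split.
  move=> x; exists d, 0%N, F, 1; split=> // [||y _].
  - exact: dhomog1.
  - by rewrite /vanishes meval1 oner_eq0.
  - rewrite (svalP (hT y)); apply: (congr1 (fun v => <[v]>%VS)); apply/rowP => j.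
    by rewrite !mxE.
move=> x v xv; rewrite (svalP (hT x)); apply/vline_eq.
  by apply: line_neq0 (svalP (hT x)).
by apply: forms_collinear hF _; apply/collinear_sym/vec_collinear.
Qed.

End MapsOfForms.

(** * The linear action and the equivariant birational map *)

Section Linearization.

Variables (k : closedFieldType) (gT : finGroupType).
Variables (L : gT -> 'M[k]_2) (b0 : 'rV[k]_2).
Hypothesis L1 : L 1%g = 1%:M.
Hypothesis LM : forall g h, L (g * h)%g = L g *m L h.

Let c1 g := L g 0 0.
Let c2 g := L g 1 0.

Lemma lin_mul g h (w : 'rV[k]_2) : lin c1 c2 h (w *m L g) = lin c1 c2 (g * h)%g w.
Proof.
have E x (v : 'rV[k]_2) : lin c1 c2 x v = (v *m L x) 0 0.
  by rewrite mulmx2 /lin /c1 /c2; ring.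
by rewrite !E LM mulmxA.
Qed.

(** Acting on w permutes the factors of norm. *)
Lemma norm_inv g (w : 'rV[k]_2) : norm c1 c2 (w *m L g) = norm c1 c2 w.
Proof.
rewrite [RHS](reindex_inj (mulgI g)) /=.
by apply: eq_bigr => h _; rewrite lin_mul.
Qed.

Lemma dnorm_inv g (w v : 'rV[k]_2) :
  dnorm c1 c2 (w *m L g) (v *m L g) = dnorm c1 c2 w v.
Proof.
rewrite [RHS](reindex_inj (mulgI g)) /=; apply: eq_bigr => h _.
rewrite lin_mul; congr (_ * _); rewrite [RHS](reindex_inj (mulgI g)) /=.
apply: eq_big => [j|j _]; last by rewrite lin_mul.
by rewrite (inj_eq (mulgI g)).
Qed.

Definition det2 g := L g 0 0 * L g 1 1 - L g 0 1 * L g 1 0.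

(** The representation V + det + det^2. *)
Definition target g : 'M[k]_(2 + 2) :=
  block_mx (L g) 0 0 (diag_mx (mk2 (det2 g) (det2 g ^+ 2))).

Lemma mul_diag2 (a b c d : k) :
  mk2 a b *m diag_mx (mk2 c d) = mk2 (a * c) (b * d).
Proof. by rewrite mul_mx_diag; apply: row2_eq; rewrite !mxE. Qed.

Lemma target_repr : mx_repr [set: gT] target.
Proof.
have d1 : det2 1%g = 1 by rewrite /det2 L1 !mxE /=; ring.
have dM g h : det2 (g * h)%g = det2 g * det2 h.
  have mulE (A B : 'M[k]_2) i j : (A *m B) i j = A i 0 * B 0 j + A i 1 * B 1 j.
    have := mulmx2 (row i A) B j; rewrite -row_mul mxE => ->.
    by rewrite !mxE.
  by rewrite /det2 LM !mulE; ring.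
split=> [|g h _ _].
  rewrite /target L1 d1 expr1n.
  have -> : mk2 1 1 = const_mx 1 :> 'rV[k]_2 by apply: row2_eq; rewrite !mxE.
  by rewrite diag_const_mx -scalar_mx_block.
rewrite /target mulmx_block !mulmx0 !mul0mx !addr0 !add0r -LM dM.
congr block_mx; apply/matrixP => i j; rewrite mul_diag_mx !mxE.
move: i j; apply: ord2_ind; apply: ord2_ind;
  by rewrite /= ?mulr1n ?mulr0n ?mulr0 // exprMn.
Qed.

Lemma target_row g (w : 'rV[k]_2) a b : row_mx w (mk2 a b) *m target g =
  row_mx (w *m L g) (mk2 (a * det2 g) (b * det2 g ^+ 2)).
Proof. by rewrite mul_row_block !mulmx0 addr0 add0r mul_diag2. Qed.

Local Notation P3 := (points (projective_space k 3)).

Lemma target_unit g : target g \in unitmx.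
Proof.
apply: inj_unitmx => w wt; have [t1 tM] := target_repr.
rewrite -[w]mulmx1 -t1 -(mulgV g) tM ?inE // mulmxA wt mul0mx //.
Qed.

Lemma target_point (p : P3) g :
  {q : P3 | line (pt q) = (linfun (mulmxr (target g)) @: line (pt p))%VS}.
Proof.
have nz : vec (pt p) *m target g != 0.
  by rewrite mulmx_unit_eq0 ?vec_neq0 ?target_unit.
have [q qE] := proj_of nz; exists (exist _ q isT).
by rewrite (line_vec (pt p)) limg_line lfunE.
Qed.

Lemma P3_inj (p q : P3) : line (pt p) = line (pt q) -> p = q.
Proof. by move=> e; apply/val_inj/line_inj. Qed.

Definition target_act (p : P3) g : P3 := sval (target_point p g).

Lemma target_actE p g (v : 'rV[k]_(2 + 2)) : line (pt p) = <[v]>%VS ->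
  line (pt (target_act p g)) = <[v *m target g]>%VS.
Proof.
by move=> pv; rewrite (svalP (target_point p g)) pv limg_line lfunE.
Qed.

Lemma target_act1 : target_act^~ 1%g =1 id.
Proof.
move=> p; apply: P3_inj; rewrite (target_actE _ (line_vec _)) line_vec.
by have [-> _] := target_repr; rewrite mulmx1.
Qed.

Lemma target_actM p : act_morph target_act p.
Proof.
move=> g h; apply: P3_inj.
rewrite (target_actE _ (line_vec _)) (target_actE _ (target_actE _ (line_vec _))).
by have [_ ->] := target_repr; rewrite ?inE // mulmxA.
Qed.

Definition target_action : {action gT &-> P3} :=
  TotalAction target_act1 target_actM.

Lemma target_linear : linear_action target_action.
Proof.
exists (MxRepresentation target_repr) => p g.
exact: (svalP (target_point p g)).
Qed.

End Linearization.

Section Birational.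

Variables (k : closedFieldType) (gT : finGroupType).
Hypothesis chark : [pchar k] =i pred0.
Variables (L : gT -> 'M[k]_2) (b0 : 'rV[k]_2).
Hypotheses (uL : forall g, L g \in unitmx) (L1 : L 1%g = 1%:M).
Hypothesis LM : forall g h, L (g * h)%g = L g *m L h.

Let c1 g := L g 0 0.
Let c2 g := L g 1 0.
Let N := #|gT|.

Let N_gt0 : (0 < N)%N. Proof. by apply/card_gt0P; exists 1%g. Qed.
Let N_neq0 : (N%:R : k) != 0. Proof. exact: card_neq0. Qed.

Definition coords n : 'rV[{mpoly k[n]}]_n := \row_i 'X_i.
Definition consts n m (x : 'rV[k]_m) : 'rV[{mpoly k[n]}]_m :=
  map_mx (@mpolyC n k) x.

Lemma meval_coords n (x : 'rV[k]_n) : map_mx (meval (x 0)) (coords n) = x.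
Proof. by apply/rowP=> i; rewrite !mxE; apply: mevalXU. Qed.

Lemma meval_consts n m (v : 'I_n -> k) (x : 'rV[k]_m) :
  map_mx (meval v) (consts n x) = x.
Proof. by apply/rowP=> i; rewrite !mxE; apply: mevalC. Qed.

Definition fwd_forms : 'I_4 -> {mpoly k[5]} := fun j =>
  fwd (fun g => (c1 g)%:MP) (fun g => (c2 g)%:MP) (consts 5 b0) (coords 5) 0 j.

Definition bwd_forms : 'I_5 -> {mpoly k[4]} := fun j =>
  bwd (fun g => (c1 g)%:MP) (fun g => (c2 g)%:MP) (consts 4 b0) (coords 4) 0 j.

Definition fwd_locus_form : {mpoly k[5]} :=
  fwd_locus (fun g => (c1 g)%:MP) (fun g => (c2 g)%:MP) (consts 5 b0) (coords 5).

Definition bwd_locus_form : {mpoly k[4]} :=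
  bwd_locus (fun g => (c1 g)%:MP) (fun g => (c2 g)%:MP) (coords 4).

Lemma fwd_formsE (x : 'rV[k]_5) :
  \row_j (fwd_forms j).@[x 0] = fwd c1 c2 b0 x.
Proof.
have := map_fwd (f := meval (x 0)) (c1 := fun g => (c1 g)%:MP)
  (c2 := fun g => (c2 g)%:MP) (d1 := c1) (d2 := c2) (consts 5 b0)
  (fun g => mevalC _ _) (fun g => mevalC _ _) (coords 5).
rewrite meval_coords meval_consts => <-.
by apply/rowP => j; rewrite [in RHS]mxE [LHS]mxE.
Qed.

Lemma bwd_formsE (p : 'rV[k]_4) :
  \row_j (bwd_forms j).@[p 0] = bwd c1 c2 b0 p.
Proof.
have := map_bwd (f := meval (p 0)) (c1 := fun g => (c1 g)%:MP)
  (c2 := fun g => (c2 g)%:MP) (d1 := c1) (d2 := c2) (consts 4 b0)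
  (fun g => mevalC _ _) (fun g => mevalC _ _) (coords 4).
rewrite [map_mx _ (coords 4)]meval_coords meval_consts => <-.
by apply/rowP => j; rewrite [in RHS]mxE [LHS]mxE.
Qed.

Lemma fwd_locus_formE (x : 'rV[k]_5) :
  fwd_locus_form.@[x 0] = fwd_locus c1 c2 b0 x.
Proof.
have := rmorph_fwd_locus (f := meval (x 0)) (c1 := fun g => (c1 g)%:MP)
  (c2 := fun g => (c2 g)%:MP) (d1 := c1) (d2 := c2) (consts 5 b0)
  (fun g => mevalC _ _) (fun g => mevalC _ _) (coords 5).
by rewrite meval_coords meval_consts.
Qed.

Lemma bwd_locus_formE (p : 'rV[k]_4) :
  bwd_locus_form.@[p 0] = bwd_locus c1 c2 p.
Proof.
have := rmorph_bwd_locus (f := meval (p 0)) (c1 := fun g => (c1 g)%:MP)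
  (c2 := fun g => (c2 g)%:MP) (d1 := c1) (d2 := c2)
  (fun g => mevalC _ _) (fun g => mevalC _ _) (coords 4).
by rewrite [map_mx _ (coords 4)]meval_coords.
Qed.

Lemma homog_crd i : crd (coords 5) i \is 1.-homog.
Proof. by rewrite /crd mxE; apply: homogX. Qed.

Lemma homog_crdX i d : crd (coords 5) i ^+ d \is d.-homog.
Proof. by have := dhomogMn d (homog_crd i); rewrite mul1n. Qed.

Lemma homog_base : homog2 1 (base (coords 5)).
Proof. by apply: homog_mk2; apply: homog_crd. Qed.

Lemma homog_fib : homog2 2 (fib (consts 5 b0) (coords 5)).
Proof.
have hM i j := dhomogM (homog_crd i) (homog_crd j).
have hC i : consts 5 b0 0 i * crd (coords 5) 4 ^+ 2 \is 2.-homog.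
  by apply: (homogM (d := 0) _ (homog_crdX 4 2)); rewrite // mxE; apply: homogC.
apply: homog_mk2; first by rewrite rpredB ?rpredN ?rpredD ?hM ?hC.
by rewrite rpredB ?hM ?hC.
Qed.

Lemma homog_fwd j : fwd_forms j \is (N + 7).-homog.
Proof.
have hn : norm _ _ _ \is N.-homog := homog_norm c1 c2 homog_base.
have hw := homog_wedge homog_base homog_fib.
have hd : dnorm _ _ _ _ \is (2 + N.-1).-homog :=
  homog_dnorm c1 c2 homog_base homog_fib.
have h2 d (u : 'rV[{mpoly k[5]}]_(2 + 2)) : homog2 d (lsubmx u) ->
    homog2 d (rsubmx u) -> forall i, u 0 i \is d.-homog.
  move=> hl hr i; rewrite -[u]hsubmxK; case: (split_ordP i) => i' ->.
    by rewrite row_mxEl.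
  by rewrite row_mxEr.
apply: h2; rewrite ?row_mxKl ?row_mxKr; apply: homog_mk2.
- apply: (homogM (homogM (homog_crdX 4 6) hn (erefl _)) (homog_base 0)).
  by move: (N) N_gt0 => n; lia.
- apply: (homogM (homogM (homog_crdX 4 6) hn (erefl _)) (homog_base 1)).
  by move: (N) N_gt0 => n; lia.
- apply: (homogM (homogM (homog_crdX 4 4) hn (erefl _)) hw).
  by move: (N) N_gt0 => n; lia.
- apply: (homogM (dhomogMn 2 hw) hd).
  by move: (N) N_gt0 => n; lia.
Qed.

Lemma homog_fwd_locus : fwd_locus_form \is (N + 4).-homog.
Proof.
have hn : norm _ _ _ \is N.-homog := homog_norm c1 c2 homog_base.
have hw := homog_wedge homog_base homog_fib.
by apply: (homogM (homogM (homog_crd 4) hn (erefl _)) hw); move: (N) N_gt0 => n; lia.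
Qed.

Lemma homog_coords4 : homog2 1 (lsubmx (coords 4 : 'rV_(2 + 2))) /\
  homog2 1 (rsubmx (coords 4 : 'rV_(2 + 2))).
Proof. by split=> i; rewrite !mxE; apply: homogX. Qed.

Lemma homog_bwd_locus : bwd_locus_form \is (N + 2).-homog.
Proof.
have [hl hr] := homog_coords4.
have hn : norm _ _ _ \is N.-homog := homog_norm c1 c2 hl.
by apply: (homogM (homogM (hl 1) hn (erefl _)) (hr 0)); move: (N) N_gt0 => n; lia.
Qed.

Lemma homog_nu n d (w y : 'rV[{mpoly k[n]}]_2) c : homog2 1 w -> homog2 d y ->
  c \is d.-homog -> forall j, nu w y c 0 j \is d.+1.-homog.
Proof.
move=> hw hy hc j; rewrite -[j]inord_val -/(crd _ _).
have M (p q : {mpoly k[n]}) :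
      p \is d.-homog -> q \is 1.-homog -> p * q \is d.+1.-homog.
  by move=> hp hq; apply: (homogM hp hq); rewrite addn1.
case: j => -[|[|[|[|[|//]]]]] ? /=; rewrite nuE ?rpredN ?M //.
by rewrite rpredD ?M.
Qed.

Lemma homog_bwd j : bwd_forms j \is (N + 3).-homog.
Proof.
have [hl hr] := homog_coords4.
have hn : norm _ _ _ \is N.-homog := homog_norm c1 c2 hl.
have hs : N%:R * rsubmx (coords 4 : 'rV_(2 + 2)) 0 0 ^+ 2 *
    norm (fun g => (c1 g)%:MP) (fun g => (c2 g)%:MP)
      (lsubmx (coords 4 : 'rV_(2 + 2))) \is (N + 2).-homog.
  have hN : (N%:R : {mpoly k[4]}) \is 0.-homog by rewrite rpredMn ?dhomog1.
  apply: (homogM (homogM hN (dhomogMn 2 (hr 0)) (erefl _)) hn).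
  by move: (N) N_gt0 => n; lia.
rewrite (_ : N + 3 = (N + 2).+1)%N; last by rewrite addnS.
apply: homog_nu => // i.
have addE (x y : 'rV[{mpoly k[4]}]_2) : (x + y) 0 i = x 0 i + y 0 i.
  by rewrite mxE.
have scaleE a (x : 'rV[{mpoly k[4]}]_2) : (a *: x) 0 i = a * x 0 i.
  by rewrite mxE.
rewrite !addE !scaleE; apply: rpredD; first apply: rpredD.
- have hb : consts 4 b0 0 i \is 0.-homog by rewrite mxE; apply: homogC.
  by apply: (homogM hs hb); rewrite addn0.
- by apply: (homogM (homogM (hr 1) hn (erefl _)) (hl i)); move: (N) N_gt0 => n; lia.
have h1 a b : homog2 0 (mk2 a%:MP b%:MP : 'rV[{mpoly k[4]}]_2).
  by apply: homog_mk2; apply: homogC.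
have hc : homog2 N.-1 (conormal (fun g => (c1 g)%:MP) (fun g => (c2 g)%:MP)
    (lsubmx (coords 4 : 'rV_(2 + 2)))).
  apply: homog_mk2; rewrite ?rpredN.
    have := homog_dnorm c1 c2 hl (h1 0 1); rewrite mpolyC0 mpolyC1 add0n //.
  have := homog_dnorm c1 c2 hl (h1 1 0); rewrite mpolyC0 mpolyC1 add0n //.
by apply: (homogM (dhomogMn 3 (hr 0)) (hc i)); move: (N) N_gt0 => n; lia.
Qed.

Definition fwd_domain : {pred proj k 4} :=
  [pred x | (x \in cubic_threefold k) && ~~ vanishes fwd_locus_form x].

Definition bwd_domain : {pred proj k 3} := [pred p | ~~ vanishes bwd_locus_form p].

Lemma fwd_domainE x (v : 'rV[k]_5) : line x = <[v]>%VS ->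
  (x \in fwd_domain) = (cubic v == 0) && (fwd_locus c1 c2 b0 v != 0).
Proof.
by move=> e; rewrite inE (cubic_pt e) (vanishesE homog_fwd_locus e) fwd_locus_formE.
Qed.

Lemma bwd_domainE p (v : 'rV[k]_4) : line p = <[v]>%VS ->
  (p \in bwd_domain) = (bwd_locus c1 c2 v != 0).
Proof.
by move=> e; rewrite inE (vanishesE homog_bwd_locus e) bwd_locus_formE.
Qed.

Local Notation nm := (norm c1 c2).
Local Notation dn := (dnorm c1 c2).
Local Notation target_pt w v :=
  (row_mx w (mk2 (wedge w v) (wedge w v ^+ 2 * dn w v / nm w)) : 'rV[k]_(2 + 2)).

Lemma fwd_domain_param x : x \in fwd_domain ->
  exists w v : 'rV[k]_2, [/\ w 0 1 != 0, nm w != 0,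
  wedge w v != 0 & line x = <[nu w (b0 + v) 1]>%VS].
Proof.
rewrite (fwd_domainE (line_vec x)) => /andP[/eqP cx Dx].
have x4 : crd (vec x) 4 != 0.
  by apply: contraNneq Dx => x4; rewrite /fwd_locus x4 !mul0r.
have [y xE] := cubic_off cx (introT orP (or_intror x4)).
have {}xE : vec x = nu (base (vec x)) (b0 + (y - b0)) 1 by rewrite addrC subrK.
move: Dx; rewrite xE fwd_locus_nu => /andP[/andP[w1 n0] a0].
by exists (base (vec x)), (y - b0); rewrite -xE -line_vec.
Qed.

Lemma bwd_domain_param p : p \in bwd_domain ->
  exists (w : 'rV[k]_2) (a b : k), [/\ w 0 1 != 0, nm w != 0,
  a != 0 & line p = <[row_mx w (mk2 a b) : 'rV[k]_(2 + 2)]>%VS].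
Proof.
rewrite (bwd_domainE (line_vec p)) => Dp.
pose q : 'rV[k]_(2 + 2) := vec p.
have qE : q = row_mx (lsubmx q) (mk2 (rsubmx q 0 0) (rsubmx q 0 1)).
  by rewrite -[LHS]hsubmxK; congr row_mx; apply: row2_eq; rewrite mk2E.
move: Dp; rewrite -/q qE bwd_locus_row mk2E => /andP[/andP[w1 n0] a0].
by exists (lsubmx q), (rsubmx q 0 0), (rsubmx q 0 1); rewrite -qE -line_vec.
Qed.

Lemma forms_line n m d (F : 'I_m.+1 -> {mpoly k[n.+1]}) (v v' : 'rV[k]_n.+1) z :
  (forall j, F j \is d.-homog) -> collinear v v' -> z != 0 ->
  collinear (\row_j (F j).@[v 0]) z -> <[\row_j (F j).@[v' 0%R]]>%VS = <[z]>%VS.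
Proof.
move=> hF vv' z0 vz; apply/esym/(vline_eq _ z0).
apply: collinear_trans (collinear_sym vz) _.
exact: forms_collinear hF vv'.
Qed.

Lemma row_neq0 (w : 'rV[k]_2) (u : 'rV[k]_2) : w 0 1 != 0 ->
  (row_mx w u : 'rV[k]_4) != 0.
Proof.
move=> w1; apply: contraNneq w1 => e.
have : lsubmx (row_mx w u) = 0 by rewrite e linear0.
by rewrite row_mxKl => ->; rewrite mxE.
Qed.

Lemma fwd_line (x : proj k 4) (w v : 'rV[k]_2) : w 0 1 != 0 -> nm w != 0 ->
    line x = <[nu w (b0 + v) 1]>%VS ->
  <[\row_j (fwd_forms j).@[vec x 0%R]]>%VS = <[target_pt w v]>%VS.
Proof.
move=> w1 n0 xE; apply: (forms_line homog_fwd (vec_collinear xE)).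
  exact: row_neq0.
by rewrite fwd_formsE; apply: fwd_collinear.
Qed.

Lemma fwd_map : {f : points fwd_domain -> points bwd_domain | regular f /\ forall x v,
  line (pt x) = <[v]>%VS ->
  line (pt (f x)) = <[\row_j (fwd_forms j).@[v 0%R]]>%VS}.
Proof.
apply: map_of_forms homog_fwd _ => x.
have nz : \row_j (fwd_forms j).@[vec (pt x) 0] != 0.
  have [w [v [w1 n0 a0 xE]]] := fwd_domain_param (valP x).
  have e := fwd_line w1 n0 xE.
  by apply: contraTneq (memv_line (target_pt w v)) => z; rewrite -e z memv0 row_neq0.
have [y yE] := proj_of nz.
have yW : y \in bwd_domain.
  have [w [v [w1 n0 a0 xE]]] := fwd_domain_param (valP x).
  have e := fwd_line w1 n0 xE.
  by rewrite (bwd_domainE (etrans yE e)) bwd_locus_row mk2E w1 n0.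
by exists (exist _ y yW).
Qed.

Lemma bwd_line (p : proj k 3) (w : 'rV[k]_2) (a b : k) :
    w 0 1 != 0 -> nm w != 0 -> a != 0 ->
    line p = <[row_mx w (mk2 a b) : 'rV[k]_(2 + 2)]>%VS ->
  exists v, [/\ wedge w v = a, a ^+ 2 * dn w v / nm w = b &
    <[\row_j (bwd_forms j).@[vec p 0%R]]>%VS = <[nu w (b0 + v) 1]>%VS].
Proof.
move=> w1 n0 a0 pE; have [v [va vb P]] := bwd_collinear b0 N_neq0 b w1 n0 a0.
exists v; split=> //; first by rewrite vb; field; rewrite a0 n0.
apply: (forms_line homog_bwd (vec_collinear pE)); last by rewrite bwd_formsE.
by apply: nu_neq01; apply: contraNneq w1 => ->; rewrite mxE.
Qed.

Lemma bwd_map : {f : points bwd_domain -> points fwd_domain | regular f /\ forall x v,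
  line (pt x) = <[v]>%VS ->
  line (pt (f x)) = <[\row_j (bwd_forms j).@[v 0%R]]>%VS}.
Proof.
apply: map_of_forms homog_bwd _ => p.
have nz : \row_j (bwd_forms j).@[vec (pt p) 0] != 0.
  have [w [a [b [w1 n0 a0 pE]]]] := bwd_domain_param (valP p).
  have [v [_ _ e]] := bwd_line w1 n0 a0 pE.
  apply: contraTneq (memv_line (nu w (b0 + v) 1)) => z; rewrite -e z memv0.
  by apply: nu_neq01; apply: contraNneq w1 => ->; rewrite mxE.
have [y yE] := proj_of nz.
have yU : y \in fwd_domain.
  have [w [a [b [w1 n0 a0 pE]]]] := bwd_domain_param (valP p).
  have [v [va _ e]] := bwd_line w1 n0 a0 pE.
  by rewrite (fwd_domainE (etrans yE e)) cubic_nu eqxx fwd_locus_nu w1 n0 va a0.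
by exists (exist _ y yU).
Qed.

Lemma good_base : exists w v : 'rV[k]_2, [/\ w 0 1 != 0, nm w != 0 & wedge w v != 0].
Proof.
pose p := \prod_g (c2 g *: 'X + (c1 g)%:P).
have p0 : p != 0.
  apply/prodf_neq0 => g _; apply: contraTneq (uL g) => e.
  have e1 : c2 g = 0.
    have := congr1 (fun q : {poly k} => q`_1) e.
    by rewrite coefD coefZ coefX coefC mulr1 addr0 coef0.
  have e0 : c1 g = 0.
    have := congr1 (fun q : {poly k} => q`_0) e.
    by rewrite coefD coefZ coefX coefC mulr0 add0r coef0.
  apply/negP => uLg; have := wedge_unit (w := mk2 1 0) (v := mk2 0 1) uLg.
  rewrite /wedge !mulmx2 !mk2E -/(c1 g) -/(c2 g) e0 e1 !(mul0r, mulr0, mulr1).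
  by rewrite subr0 oner_eq0 !addr0 mul0r mulr0 subrr eqxx => /(_ isT).
have [|t pt0] := nonroot (p := 'X * p); first by rewrite mulf_neq0 ?polyX_eq0.
move: pt0; rewrite hornerM hornerX mulf_eq0 negb_or => /andP[t0 pt].
have w0 : mk2 1 t != 0 :> 'rV[k]_2 by apply: mk2_neq0r.
have [v wv] := exists_noncollinear w0; exists (mk2 1 t), v; rewrite mk2E; split=> //.
rewrite /norm (_ : \prod_i _ = p.[t]) // horner_prod; apply: eq_bigr => g _.
by rewrite /lin !mk2E !hornerE addrC.
Qed.

Lemma fwd_domain_open : zariski_open (cubic_threefold k) fwd_domain.
Proof.
split=> [x /andP[]//|x /andP[_ hx]].
exists (N + 4)%N, fwd_locus_form; split=> // [|y yX hy].
  exact: homog_fwd_locus.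
by rewrite inE yX.
Qed.

Lemma bwd_domain_open : zariski_open (projective_space k 3) bwd_domain.
Proof.
split=> // x hx; exists (N + 2)%N, bwd_locus_form; split=> //.
exact: homog_bwd_locus.
Qed.

(** X is the image of the vector space k^2 x k^3, in which any two points lie
    on a line: a form that does not vanish at one end of it is not zero on the
    whole line, nor is the form that cuts out the complement of
    the domain. *)
Lemma fwd_domain_dense : zariski_dense (cubic_threefold k) fwd_domain.
Proof.
split=> [x /andP[]//|e h hh [x xX hx]].
have [w1 [v1 [w11 n1 a1]]] := good_base.
have cx : cubic (vec x) = 0 by move: xX; rewrite (cubic_pt (line_vec x)) => /eqP.
have [w0 [y0 [c0 [w00 xE]]]] := cubic_param cx.
pose V := nu (ray w0 (w1 - w0)) (ray y0 (b0 + v1 - y0)) (c0%:P + (1 - c0) *: 'X).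
have VE t : pt_at t V = nu (w0 + t *: (w1 - w0)) (y0 + t *: (b0 + v1 - y0))
    (c0 + (1 - c0) * t).
  by rewrite pt_at_nu !pt_at_ray !hornerE.
have V0 : pt_at 0 V = vec x by rewrite VE !scale0r mulr0 !addr0 -xE.
have V1 : pt_at 1 V = nu w1 (b0 + v1) 1.
  by rewrite VE !scale1r mulr1 ![_ + (_ - _)]addrC !subrK.
have [|t] := nonroot (p := along h V * along fwd_locus_form V).
  rewrite mulf_neq0 //.
    apply: contraNneq hx => hV; rewrite (vanishesE hh (line_vec x)).
    by rewrite -V0 -horner_along hV horner0.
  have : (along fwd_locus_form V).[1] != 0.
    by rewrite horner_along fwd_locus_formE V1 fwd_locus_nu w11 n1.
  by apply: contraNneq => ->; rewrite horner0.
rewrite hornerM mulf_eq0 negb_or !horner_along fwd_locus_formE => /andP[ht Dt].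
have z0 : pt_at t V != 0.
  by apply: contraNneq Dt => ->; rewrite /fwd_locus crd0 !mul0r.
have [z zE] := proj_of z0; exists z; last by rewrite (vanishesE hh zE).
by rewrite (fwd_domainE zE) Dt VE cubic_nu eqxx.
Qed.

Lemma bwd_domain_dense : zariski_dense (projective_space k 3) bwd_domain.
Proof.
split=> // e h hh [x _ hx].
have [w1 [v1 [w11 n1 a1]]] := good_base.
pose p1 : 'rV[k]_4 := row_mx w1 (mk2 1 0).
pose V := ray (vec x) (p1 - vec x).
have V0 : pt_at 0 V = vec x by apply: pt_at_ray0.
have V1 : pt_at 1 V = p1 by rewrite pt_at_ray scale1r addrC subrK.
have Dp1 : bwd_locus c1 c2 p1 != 0.
  by rewrite bwd_locus_row mk2E w11 n1 oner_neq0.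
have [|t] := nonroot (p := along h V * along bwd_locus_form V).
  rewrite mulf_neq0 //.
    apply: contraNneq hx => hV; rewrite (vanishesE hh (line_vec x)).
    by rewrite -V0 -horner_along hV horner0.
  have : (along bwd_locus_form V).[1] != 0.
    by rewrite horner_along bwd_locus_formE V1.
  by apply: contraNneq => ->; rewrite horner0.
rewrite hornerM mulf_eq0 negb_or !horner_along bwd_locus_formE => /andP[ht Dt].
have z0 : pt_at t V != 0.
  apply: contraNneq Dt => ->; rewrite /bwd_locus linear0 mxE !mul0r //.
have [z zE] := proj_of z0; exists z; last by rewrite (vanishesE hh zE).
by rewrite (bwd_domainE zE).
Qed.

Variable to : {action gT &-> points (cubic_threefold k)}.
Hypothesis to_diag : forall g a (w v : 'rV[k]_2), w != 0 ->
  line (pt a) = <[nu w (b0 + v) 1]>%VS ->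
  line (pt (to a g)) = <[nu (w *m L g) (b0 + v *m L g) 1]>%VS.

Lemma birational_target :
  equivariantly_birational to (target_action L1 LM).
Proof.
have [f [rf fE]] := fwd_map; have [f' [rf' f'E]] := bwd_map.
have fP (x : points fwd_domain) (w v : 'rV[k]_2) : w 0 1 != 0 -> nm w != 0 ->
    line (pt x) = <[nu w (b0 + v) 1]>%VS ->
    line (pt (f x)) = <[target_pt w v]>%VS.
  by move=> w1 n0 xE; rewrite (fE _ _ (line_vec _)) (fwd_line w1 n0 xE).
exists fwd_domain, bwd_domain, f, f'; split.
- by split; [apply: fwd_domain_open|apply: fwd_domain_dense].
- by split; [apply: bwd_domain_open|apply: bwd_domain_dense].
- by [].
- split=> [x|p]; apply/val_inj/line_inj.
    have [w [v [w1 n0 a0 xE]]] := fwd_domain_param (valP x).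
    have fx := fP x w v w1 n0 xE.
    have [v' [va vb e]] := bwd_line w1 n0 a0 fx.
    have w0 : w != 0 by apply: contraNneq w1 => ->; rewrite mxE.
    have vv : v' = v.
      apply: (wedge_dnorm_inj N_neq0 n0 w0 va).
      have a20 : wedge w v ^+ 2 / nm w != 0.
        by rewrite mulf_neq0 ?invr_eq0 ?expf_neq0.
      by apply: (mulfI a20); rewrite ![_ / _ * _]mulrAC.
    by rewrite [LHS](f'E _ _ (line_vec _)) e vv -xE.
  have [w [a [b [w1 n0 a0 pE]]]] := bwd_domain_param (valP p).
  have [v [va vb e]] := bwd_line w1 n0 a0 pE.
  have f'p : line (pt (f' p)) = <[nu w (b0 + v) 1]>%VS.
    by rewrite (f'E _ _ (line_vec _)) e.
  by rewrite [LHS](fP _ w v w1 n0 f'p) va vb -pE.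
move=> g a b x y xa ya fxb; apply: line_inj.
have [w [v [w1 n0 a0 xE]]] := fwd_domain_param (valP x).
have w0 : w != 0 by apply: contraNneq w1 => ->; rewrite mxE.
have yE : line (pt y) = <[nu (w *m L g) (b0 + v *m L g) 1]>%VS.
  by rewrite ya; apply: to_diag w0 _; rewrite -xa.
have := valP y; rewrite (fwd_domainE yE) fwd_locus_nu.
case/andP=> _ /andP[/andP[w1' n0'] _].
rewrite (fP _ _ _ w1' n0' yE).
have bE : line (pt b) = <[target_pt w v]>%VS by rewrite -fxb (fP _ _ _ w1 n0 xE).
rewrite [RHS](target_actE L1 LM g bE) target_row norm_inv // dnorm_inv //.
rewrite wedge_mulmx -/(det2 L g).
apply: (congr1 (fun u => <[row_mx (w *m L g) u]>%VS)).
by apply: row2_eq; rewrite !mk2E; [ring | field].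
Qed.

End Birational.

Theorem theorem6p2 (k : closedFieldType) (chark : [pchar k]%R =i pred0)
  (gT : finGroupType) (to : {action gT &-> points (cubic_threefold k)})
  (toAut : finite_subgroup_Aut to) :
  linearizable 3 to.
Proof.
have [reg_to _] := toAut.
have [L [b0 [uL L1 LM hL]]] := diagonal_action chark reg_to.
exists (target_action L1 LM); split; first exact: target_linear.
exact: (birational_target chark uL L1 LM hL).
Qed.
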